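(* Let $n\in\mathbb{N}$, $n\ge 1$. Let $$Z=\{z=(z_1,\dots,z_n)\in\mathbb{R}^n : 0<z_1<\cdots<z_n<1\},\qquad M=\Big\{z\in\mathbb{R}^n : \sum_{k=1}^n(-1)^k z_k=\tfrac{(-1)^n}{2}\Big\}.$$ For $z\in M\cap Z$ let $E_\gamma(z):=E_\gamma(u_z)$, where $u_z$ is the axisymmetric pattern on $\mathbb{S}^2$, symmetric with respect to the equator, with the $2n$ interfaces located at $\pm z_1,\dots,\pm z_n$. Then, provided $\gamma>0$ is sufficiently large (depending on $n$), the function $z\mapsto E_\gamma(z)$ admits a local minimizer in the set $M\cap Z$, i.e. there is a point of $M\cap Z$ at which $E_\gamma$ restricted to $M\cap Z$ has a local minimum.
   Context: For $u\in BV(\mathbb{S}^2;\{\pm1\})$ with $\frac1{4\pi}\int_{\mathbb{S}^2}u\,d\mathcal{H}^2=m$ and $\gamma>0$, the energy is $$E_\gamma(u)=\frac12\int_{\mathbb{S}^2}|\nabla u|+\gamma\int_{\mathbb{S}^2}|\nabla v|^2\,d\mathcal{H}^2,$$ where $\int_{\mathbb{S}^2}|\nabla u|$ is the total variation of $u$, $v$ solves $-\Delta v=u-m$ on $\mathbb{S}^2$ ($\Delta$ is the Laplace--Beltrami operator of the unit sphere $\mathbb{S}^2$, and $v$ is unique up to an additive constant) and $\nabla$ is the gradient on $\mathbb{S}^2$. Here $m=0$. Functions on $\mathbb{S}^2$ depending only on the polar angle $\phi$ are regarded as functions of $z=\cos\phi\in[-1,1]$. An axisymmetric pattern with interfaces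 at $-1=\zeta_0<\zeta_1<\dots<\zeta_N<\zeta_{N+1}=1$ is the function $u$ with $u=(-1)^{k+1}$ on $[\zeta_k,\zeta_{k+1})$ for $k=0,\dots,N$ (the value at $z=1$ is immaterial). For $z\in Z$ the pattern $u_z$ has $N=2n$ interfaces $-z_n<\dots<-z_1<z_1<\dots<z_n$; the condition $z\in M$ expresses exactly the mass constraint $\int_{\mathbb{S}^2}u_z\,d\mathcal{H}^2=0$. *)

(* Defs.v *)
From HB Require Import structures.
From mathcomp Require Import all_boot all_order all_algebra.
From mathcomp Require Import all_classical all_reals all_analysis.

Set Implicit Arguments.
Unset Strict Implicit.
Unset Printing Implicit Defensive.

Import Order.TTheory GRing.Theory Num.Theory.
Import numFieldNormedType.Exports.

Local Open Scope classical_set_scope.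
Local Open Scope ring_scope.

(* Functions and vector fields on S^2 are represented by functions on R^3;
   every notion below depends only on their values on S^2 (the tangential
   derivatives do not depend on the C^1 extension).  A function on S^2 is of
   class C^1 iff it is the restriction of a C^1 function on R^3. *)

Definition dot (R : realType) (x y : 'rV[R]_3) : R :=
  \sum_(i < 3) x 0 i * y 0 i.

Definition sphere (R : realType) : set 'rV[R]_3 := [set x | dot x x = 1].

Definition spherical (R : realType) (phi theta : R) : 'rV[R]_3 :=
  \row_(i < 3) [:: sin phi * cos theta; sin phi * sin theta; cos phi]`_i.

(* Integral over S^2 with respect to H^2, whose density in the coordinates
   (phi, theta) is sin phi. *)
Definition sphere_integral (R : realType) (f : 'rV[R]_3 -> R) : R :=
  Rintegral (@lebesgue_measure R \x @lebesgue_measure R)%E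
    (`[0, pi] `*` `[0, 2 * pi])
    (fun p => f (spherical p.1 p.2) * sin p.1).

Definition sphere_mean (R : realType) (u : 'rV[R]_3 -> R) : R :=
  (4 * pi)^-1 * sphere_integral u.

Definition C1 (R : realType) (f : 'rV[R]_3 -> R) : Prop :=
  (forall x, differentiable f x) /\
  (forall w : 'rV[R]_3, continuous (fun x => 'D_w f x)).

Definition grad (R : realType) (f : 'rV[R]_3 -> R) (x : 'rV[R]_3) : 'rV[R]_3 :=
  \row_(i < 3) 'D_(delta_mx 0 i) f x.

Definition sphere_grad (R : realType) (f : 'rV[R]_3 -> R) (x : 'rV[R]_3) :
    'rV[R]_3 :=
  grad f x - dot (grad f x) x *: x.

Definition sphere_div (R : realType) (X : 'rV[R]_3 -> 'rV[R]_3)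
    (x : 'rV[R]_3) : R :=
  \sum_(i < 3) sphere_grad (fun y => X y 0 i) x 0 i.

Definition admissible_field (R : realType) (X : 'rV[R]_3 -> 'rV[R]_3) : Prop :=
  (forall i, C1 (fun y => X y 0 i)) /\
  (forall x, sphere x -> dot (X x) x = 0 /\ dot (X x) (X x) <= 1).

Definition total_variation_sphere (R : realType) (u : 'rV[R]_3 -> R) : \bar R :=
  ereal_sup [set (sphere_integral (fun x => u x * sphere_div X x))%:E
            | X in @admissible_field R].

(* Weak form of - Delta v = u - m with m the mean of u.  For bounded u the
   H^1 solution lies in W^{2,p} for all p < oo, hence is C^1. *)
Definition poisson_solution (R : realType) (u v : 'rV[R]_3 -> R) : Prop :=
  C1 v /\
  forall f : 'rV[R]_3 -> R, C1 f ->
    sphere_integral (fun x => dot (sphere_grad v x) (sphere_grad f x)) =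
    sphere_integral (fun x => (u x - sphere_mean u) * f x).

(* A chosen solution; any two have the same sphere_grad on S^2.  The default
   value 0 is only taken if there is no solution, which does not happen for
   bounded measurable u. *)
Definition potential (R : realType) (u : 'rV[R]_3 -> R) : 'rV[R]_3 -> R :=
  xget (fun=> 0) [set v | poisson_solution u v].

Definition energy (R : realType) (gamma : R) (u : 'rV[R]_3 -> R) : \bar R :=
  ((2^-1)%:E * total_variation_sphere u +
   (gamma * sphere_integral (fun x =>
      dot (sphere_grad (potential u) x) (sphere_grad (potential u) x)))%:E)%E.

(* For interfaces s = [:: zeta_1; ...; zeta_N] in increasing order, exactly k
   of them are <= x_3 when x_3 lies in [zeta_k, zeta_(k+1)). *)
Definition axisymmetric_pattern (R : realType) (s : seq R) (x : 'rV[R]_3) : R :=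
  (-1) ^+ (count (fun a => a <= x 0 ord_max) s).+1.

Definition symmetric_interfaces (R : realType) (n : nat) (z : 'rV[R]_n) :
    seq R :=
  let s := [seq z 0 i | i <- enum 'I_n] in [seq - a | a <- rev s] ++ s.

Definition Zset (R : realType) (n : nat) : set 'rV[R]_n :=
  [set z | [/\ forall i, 0 < z 0 i,
               forall i j : 'I_n, (i < j)%N -> z 0 i < z 0 j
             & forall i, z 0 i < 1]].

(* The coordinate z_k is z 0 i with k = i + 1. *)
Definition Mset (R : realType) (n : nat) : set 'rV[R]_n :=
  [set z | \sum_(i < n) (-1) ^+ i.+1 * z 0 i = (-1) ^+ n / 2].

Definition pattern_energy (R : realType) (n : nat) (gamma : R)
    (z : 'rV[R]_n) : \bar R :=
  energy gamma (axisymmetric_pattern (symmetric_interfaces z)).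

(* Main.v *)
From mathcomp Require Import all_boot all_order all_algebra.
From mathcomp Require Import all_classical all_reals all_analysis.
From mathcomp Require Import measurable_realfun ring lra.
Require Import Defs.
Set Implicit Arguments.
Unset Strict Implicit.
Unset Printing Implicit Defensive.
Import Order.TTheory GRing.Theory Num.Theory.
Import numFieldNormedType.Exports.
Local Open Scope classical_set_scope.
Local Open Scope ring_scope.

(** Why the theorem holds.  Write W(t) for the integral of the pattern u over
    heights between -1 and t (the function [moment]).  The mass constraint says
    W(1) = 0, and for an axisymmetric v the equation - Delta v = u reads
    (1 - t^2) v'(t) = - W(t); hence the Dirichlet energy of v is, in polar
    coordinates, the integral of W(cos phi)^2 / sin phi.

    The key is to describe a pattern by the zeros of W instead of its
    interfaces.  W is odd and piecewise linear with slopes 1 and -1, so between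
    two consecutive zeros its graph is a tent whose apex, an interface, is the
    midpoint.  On the upper half the zeros are 0 = c_0 < c_1 < ... < c_n = 1,
    the interfaces are z_i = (c_(i-1) + c_i) / 2, and the mass constraint is
    just c_n = 1 ([Mset_node]).  Moreover |W(t)| is the distance of |t| to the
    nearest zero ([moment_sqr] is the tent form of this), so the Dirichlet
    energy is a quantization error: the more zeros, the smaller it is.

    Let the zeros range over the compact simplex 0 = c_0 <= ... <= c_n = 1.  On
    its boundary two zeros coincide, and moving one of them into the middle of
    a neighbouring gap strictly lowers the Dirichlet energy
    ([degenerate_not_optimal]).  So the minimum of the Dirichlet energy is
    strictly smaller than its values on the boundary.  The perimeter is
    nonnegative and lower semicontinuous, being a supremum of functionals that
    are continuous in z, so the total energy attains its minimum on the
    simplex, and for large gamma that minimum cannot be on the boundary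
    ([strong_confinement]).  An interior minimizer is the required point,
    because near it every point of M is in the simplex.

    The analytic input is [cap_identity], an integration by parts along
    meridians for the spherical cap above height a.  A pattern is an
    alternating sum of such caps, and so the identity yields the weak Poisson
    equation ([pattern_poisson]); its special case for constants gives the
    area of a cap, from which the continuity of the functionals in z follows. *)

(** * Integration over the rectangle of polar coordinates *)

Section Measurability.
Variable R : realType.
Local Notation mu := (@lebesgue_measure R).

Local Notation plane := (measurableTypeR R * measurableTypeR R)%type.

(** An open set of the plane is a countable union of products of rational balls,
    so it belongs to the product sigma-algebra. *)
Lemma open_plane_measurable (U : set (R * R)) : open U -> measurable (U : set plane).
Proof.
move=> oU.
pose box (q : (rat * rat) * (rat * rat)) : set plane :=
  ball (ratr q.1.1 : R) (ratr q.1.2) `*` ball (ratr q.2.1 : R) (ratr q.2.2).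
have -> : U = \bigcup_q (box q `&` [set _ | box q `<=` U]).
  apply/seteqP; split=> [[x y] Uxy|p [q _ [qp qU]]]; last exact: qU.
  have [[A B] /= [Ax By] ABU] : nbhs (x, y) U by exact: open_nbhs_nbhs.
  have [c1 [r1 [xc1 cA]]] : exists c r : rat,
      let B : set R := ball (ratr c : R) (ratr r) in x \in B /\ B `<=` A°.
    by apply: open_subball_rat; [exact: open_interior|rewrite inE].
  have [c2 [r2 [yc2 cB]]] : exists c r : rat,
      let C : set R := ball (ratr c : R) (ratr r) in y \in C /\ C `<=` B°.
    by apply: open_subball_rat; [exact: open_interior|rewrite inE].
  exists ((c1, r1), (c2, r2)) => //; split.
    by split => /=; exact/set_mem.
  move=> [s t] /= [bs bt]; apply: ABU; split => /=.
    exact: (interior_subset (cA _ bs)).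
  exact: (interior_subset (cB _ bt)).
apply: countable_bigcupT_measurable; first exact: countableP.
move=> q; apply: measurableI; first by apply: measurableX; exact: measurable_ball.
have [qU|qU] := pselect (box q `<=` U).
  by rewrite (_ : [set _ | _] = setT)//; apply/seteqP; split.
by rewrite (_ : [set _ | _] = set0)//; apply/seteqP; split.
Qed.

Lemma continuous_plane_measurable (f : R * R -> R) :
  continuous f -> measurable_fun (setT : set plane) f.
Proof.
move=> cf; apply: (measurability _ (RGenOpens.measurableE R)) => _ [_ [a [b ->]] <-].
by rewrite setTI; apply: open_plane_measurable; apply: open_comp => // p _; exact: cf.
Qed.

(** The type [plane] carries the product of the sigma-algebras on which
    Lebesgue measure is defined, so that the measure [area] below is the one
    in the definition of [sphere_integral]. *)
Definition polar_rect : set plane := `[0, pi] `*` `[0, 2 * pi].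
Definition area : {measure set plane -> \bar R} := (mu \x mu)%E.

Lemma polar_rect_measurable : measurable polar_rect.
Proof. by apply: measurableX. Qed.

Lemma lebesgue_segment (a b : R) : a <= b -> mu `[a, b] = (b - a)%:E.
Proof.
move=> ab; rewrite lebesgue_measure_itv/= lte_fin -EFinB.
by case: ltgtP ab => // -> _; rewrite subrr.
Qed.

Lemma polar_rect_mass : (area polar_rect = (2 * pi ^+ 2)%:E)%E.
Proof.
transitivity ((mu `[0%R, pi] * mu `[0%R, (2 * pi)%R])%E : \bar R).
  by apply: product_measure1E.
rewrite !lebesgue_segment ?mulr_ge0 ?pi_ge0//.
by rewrite !subr0 -EFinM; congr (_%:E); rewrite expr2 mulrCA.
Qed.

Lemma polar_rect_integrable (k : plane -> R) (C : R) :
  measurable_fun (setT : set plane) k ->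
  (forall p, polar_rect p -> `|k p| <= C) ->
  area.-integrable polar_rect (EFin \o k).
Proof.
move=> mk kC; apply: measurable_bounded_integrable.
- exact: polar_rect_measurable.
- by rewrite polar_rect_mass ltry.
- exact: measurable_funS mk.
- by exists C; split; rewrite ?num_real// => x Cx p /kC /le_trans; apply; exact: ltW.
Qed.

(** The inner integral runs over the angle [x] from the pole, so that it can be
    computed along each meridian. *)
Lemma polar_fubini (k : plane -> R) (C : R) : measurable_fun (setT : set plane) k ->
  (forall p, polar_rect p -> `|k p| <= C) ->
  \int[area]_(p in polar_rect) k p =
  \int[mu]_(y in `[0, 2 * pi]) \int[mu]_(x in `[0, pi]) k (x, y).
Proof.
move=> mk kC; rewrite {1}/Rintegral integral_mkcond/=.
have intk := polar_rect_integrable mk kC.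
have mR := polar_rect_measurable.
have intk' : area.-integrable setT ((EFin \o k) \_ polar_rect).
  have := (integrable_mkcond (EFin \o k) mR).1 intk. move=> h; refine h.
rewrite -integral21_prod_meas1// /Rintegral; congr fine.
rewrite [RHS]integral_mkcond; apply: eq_integral => y _.
rewrite /fubini_G patchE; case: ifPn => yI; last first.
  rewrite integral0_eq// => x _; rewrite patchE memNset//= => -[_ /=].
  by apply/negP; move: yI; rewrite notin_setE /= => /negP.
rewrite (_ : (fun x => _) = ((fun x => (k (x, y))%:E) \_ `[0, pi])); last first.
  apply/funext => x; rewrite !patchE; move: yI; rewrite inE /= => yI.
  case: ifPn; first by rewrite inE => -[/= xI _]; rewrite mem_set.
  by rewrite notin_setE => xyI; rewrite memNset// => xI; apply: xyI.
rewrite -integral_mkcond fineK//; apply: integrable_fin_num => //.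
apply: measurable_bounded_integrable => //.
- suff : (mu `[0%R, pi] < +oo)%E by [].
  by rewrite lebesgue_segment ?pi_ge0// ltry.
- apply: measurable_funS (measurable_fun_pair1 y mk) => //.
- exists C; split; rewrite ?num_real// => x Cx t tI.
  apply: le_trans (ltW Cx); apply: kC; split=> //=.
  by move: yI; rewrite inE.
Qed.

End Measurability.

Section Tame.
Variable R : realType.
Local Notation mu := (@lebesgue_measure R).
Local Notation plane := (measurableTypeR R * measurableTypeR R)%type.

(** A class of integrands that is closed under sums and products and contains
    continuous functions and indicators of caps; within it the integral is
    linear and monotone without further side conditions. *)
Definition tame (k : plane -> R) := measurable_fun (setT : set plane) k /\
  exists C, forall p, polar_rect p -> `|k p| <= C.

Definition polar_integral (k : plane -> R) : R :=
  \int[area R]_(p in @polar_rect R) k p.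

Implicit Types f g k : plane -> R.

Lemma tame_integrable k : tame k -> (area R).-integrable (@polar_rect R) (EFin \o k).
Proof. by move=> [mk [C kC]]; exact: polar_rect_integrable kC. Qed.

Lemma tame_cst (c : R) : tame (fun=> c).
Proof. by split; [exact: measurable_cst|exists `|c|]. Qed.

Lemma tameD f g : tame f -> tame g -> tame (fun p => f p + g p).
Proof.
move=> [mf [C fC]] [mg [D gD]]; split; first exact: measurable_funD.
exists (C + D) => p pR; apply: le_trans (ler_normD _ _) _.
by rewrite lerD ?fC ?gD.
Qed.

Lemma tameM f g : tame f -> tame g -> tame (fun p => f p * g p).
Proof.
move=> [mf [C fC]] [mg [D gD]]; split; first exact: measurable_funM.
by exists (C * D) => p pR; rewrite normrM ler_pM ?fC ?gD.
Qed.

Lemma tameZ (c : R) g : tame g -> tame (fun p => c * g p).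
Proof. by apply: tameM; exact: tame_cst. Qed.

Lemma tameN f : tame f -> tame (fun p => - f p).
Proof.
move=> /(tameZ (-1)); congr tame.
by apply/funext => p; rewrite mulN1r.
Qed.

Lemma tameB f g : tame f -> tame g -> tame (fun p => f p - g p).
Proof. by move=> tf tg; apply: tameD => //; exact: tameN. Qed.

Lemma tame_sum (I : Type) (s : seq I) (f : I -> plane -> R) :
  (forall i, tame (f i)) -> tame (fun p => \sum_(i <- s) f i p).
Proof.
move=> tf; elim: s => [|i s IH].
  by under eq_fun do rewrite big_nil; exact: tame_cst.
by under eq_fun do rewrite big_cons; exact: tameD.
Qed.

Lemma tame_norm f : tame f -> tame (fun p => `|f p|).
Proof.
move=> [mf [C fC]]; split.
  exact: measurableT_comp (@normr_measurable R setT) mf.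
by exists C => p /fC; rewrite normr_id.
Qed.

Lemma polar_rect_compact : compact (@polar_rect R : set (R * R)).
Proof. by apply: compact_setX; exact: segment_compact. Qed.

Lemma tame_continuous (k : R * R -> R) : continuous k -> tame k.
Proof.
move=> ck; split; first exact: continuous_plane_measurable.
have /compact_bounded[C [_ kC]] : compact (k @` (@polar_rect R : set (R * R))).
  apply: continuous_compact; last exact: polar_rect_compact.
  by apply: continuous_subspaceT => p; exact: ck.
exists (C + 1) => p pR; apply: (kC (C + 1)); first by rewrite ltrDl.
by exists p.
Qed.

(** For a function of the angle from the pole alone, measurability and a bound on
    one variable suffice; this covers indicators of caps and the densities with
    the factor 1 / sin. *)
Lemma tame_latitude (h : R -> R) (C : R) : measurable_fun setT h ->
  (forall x, `[0, pi]%classic x -> `|h x| <= C) -> tame (fun p => h p.1).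
Proof.
move=> mh hC; split; first exact: measurableT_comp mh measurable_fst.
by exists C => -[x y] [/= xI _]; exact: hC.
Qed.

Lemma polar_integralD f g : tame f -> tame g ->
  polar_integral (fun p => f p + g p) = polar_integral f + polar_integral g.
Proof.
by move=> tf tg; rewrite /polar_integral RintegralD//;
  [exact: polar_rect_measurable|exact: tame_integrable|exact: tame_integrable].
Qed.

Lemma polar_integralZ c f : tame f ->
  polar_integral (fun p => c * f p) = c * polar_integral f.
Proof.
by move=> tf; rewrite /polar_integral RintegralZl//;
  [exact: polar_rect_measurable|exact: tame_integrable].
Qed.

Lemma polar_integralN f : tame f ->
  polar_integral (fun p => - f p) = - polar_integral f.
Proof.
move=> tf; rewrite -[RHS]mulN1r -polar_integralZ//; congr polar_integral.
by apply/funext => p; rewrite mulN1r.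
Qed.

Lemma polar_integralB f g : tame f -> tame g ->
  polar_integral (fun p => f p - g p) = polar_integral f - polar_integral g.
Proof.
by move=> tf tg; rewrite polar_integralD ?polar_integralN//; exact: tameN.
Qed.

Lemma eq_polar_integral f g : (forall p, polar_rect p -> f p = g p) ->
  polar_integral f = polar_integral g.
Proof. by move=> fg; apply: eq_Rintegral => p; rewrite inE => /fg. Qed.

Lemma polar_integral_cst c : polar_integral (fun=> c) = c * (2 * pi ^+ 2).
Proof.
rewrite /polar_integral Rintegral_cst; last exact: polar_rect_measurable.
by rewrite polar_rect_mass.
Qed.

Lemma polar_integral_sum (I : Type) (s : seq I) (f : I -> plane -> R) :
  (forall i, tame (f i)) ->
  polar_integral (fun p => \sum_(i <- s) f i p) =
  \sum_(i <- s) polar_integral (f i).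
Proof.
move=> tf; elim: s => [|i s IH].
  under eq_fun do rewrite big_nil.
  by rewrite big_nil polar_integral_cst mul0r.
under eq_fun do rewrite big_cons.
by rewrite big_cons polar_integralD ?IH//; exact: tame_sum.
Qed.

Lemma le_polar_integral f g : tame f -> tame g ->
  (forall p, polar_rect p -> f p <= g p) -> polar_integral f <= polar_integral g.
Proof.
move=> tf tg fg; apply: le_Rintegral => //;
  [exact: polar_rect_measurable|exact: tame_integrable|exact: tame_integrable].
Qed.

Lemma le_norm_polar_integral f : tame f ->
  `|polar_integral f| <= polar_integral (fun p => `|f p|).
Proof.
move=> tf; apply: le_normr_Rintegral;
  [exact: polar_rect_measurable|exact: tame_integrable].
Qed.

Lemma is_derive_continuous (F f : R -> R) :
  (forall x : R, is_derive x 1 F (f x)) -> continuous F.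
Proof.
move=> dF x; have dFx : derivable F x 1 by [].
exact/differentiable_continuous/derivable1_diffP.
Qed.

Lemma FTC2_everywhere (F f : R -> R) (a b : R) : a <= b -> continuous f ->
  (forall x : R, is_derive x 1 F (f x)) ->
  \int[mu]_(x in `[a, b]) f x = F b - F a.
Proof.
rewrite le_eqVlt => /predU1P[<- _ _|ab cf dF].
  by rewrite set_itv1 Rintegral_set1 subrr.
have cF := is_derive_continuous dF.
rewrite /Rintegral (@continuous_FTC2 _ f F)//.
- exact: continuous_subspaceT.
- split=> //; first by apply: cvg_at_right_filter; exact: cF.
  by apply: cvg_at_left_filter; exact: cF.
- by move=> x _; rewrite derive1E derive_val.
Qed.

(** [step a] is the indicator of the heights above [a]; [ramp a] is its primitive
    that vanishes below [a]. *)
Definition step (a t : R) : R := (a <= t)%R%:R.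
Definition ramp (a t : R) : R := Num.max 0 (t - a).

Lemma rampE a t : ramp a t = step a t * (t - a).
Proof.
rewrite /ramp /step; case: (leP a t) => h /=.
  by rewrite mul1r max_r// subr_ge0.
by rewrite mul0r max_l// subr_le0 ltW.
Qed.

(** The function (cos x - a) F(x) vanishes at [acos a], where the cap ends, so the
    integration by parts over `[0, acos a]` only leaves the boundary term at the
    pole. *)
Lemma cap_by_parts (a : R) (F f : R -> R) : -1 <= a <= 1 -> continuous f ->
  (forall x : R, is_derive x 1 F (f x)) ->
  \int[mu]_(x in `[0, pi])
     (step a (cos x) * (sin x * F x) - ramp a (cos x) * f x) = (1 - a) * F 0.
Proof.
move=> aI cf dF.
(* on [0, pi] the condition a <= cos x means x <= acos a *)
have acI : acos a \in `[0, pi] by rewrite in_itv/= acos_ge0 ?acos_lepi.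
pose G x := (a - cos x) * F x.
pose g x := sin x * F x - (cos x - a) * f x.
have cF := is_derive_continuous dF.
have dG (x : R) : is_derive x 1 G (g x).
  rewrite /G /g; apply: is_derive_eq.
  rewrite /= /GRing.scale/=; ring.
transitivity (\int[mu]_(x in `[0, pi]) (g \_ `[0, acos a]) x).
  apply: (@eq_Rintegral _ _ _ mu) => x; rewrite inE/= => xI.
  have -> : step a (cos x) = (x <= acos a)%R%:R.
    by rewrite /step -{1}[a](@acosK R) ?in_itv//= leNgt ltr_cos// -leNgt.
  have -> : ramp a (cos x) = (x <= acos a)%R%:R * (cos x - a).
    by rewrite rampE /step -{1}[a](@acosK R) ?in_itv//= leNgt ltr_cos// -leNgt.
  rewrite patchE.
  case: ifPn; rewrite ?inE ?notin_setE /= in_itv/= (itvP xI)/=.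
    by move=> ->; rewrite !mul1r.
  by move=> /negP/negbTE ->; rewrite !mul0r subrr.
rewrite -Rintegral_mkcondr setIidr; last first.
  by move=> x /=; rewrite !in_itv/= => /andP[-> /le_trans]; apply; rewrite (itvP acI).
rewrite (FTC2_everywhere (F := G)) ?(itvP acI)//.
  by rewrite /G acosK ?in_itv// cos0 subrr mul0r sub0r -mulNr opprB.
move=> x; rewrite /g; apply: cvgB; apply: cvgM.
- exact: continuous_sin.
- exact: cF.
- by apply: cvgB; [exact: continuous_cos|exact: cvg_cst].
- exact: cf.
Qed.

End Tame.

(** * Spherical coordinates and derivatives along meridians *)

Section Spherical.
Variable R : realType.
Local Notation i0 := (@Ordinal 3 0 isT).
Local Notation i1 := (@Ordinal 3 1 isT).
Local Notation i2 := (@Ordinal 3 2 isT).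

Lemma continuous_latitude (T : topologicalType) (g : R -> T) :
  continuous g -> continuous (fun p : R * R => g p.1).
Proof. by move=> cg p; apply: (continuous_comp cvg_fst); exact: cg. Qed.

Lemma continuous_longitude (T : topologicalType) (g : R -> T) :
  continuous g -> continuous (fun p : R * R => g p.2).
Proof. by move=> cg p; apply: (continuous_comp cvg_snd); exact: cg. Qed.

Lemma continuous_sin_polar : continuous (fun p : R * R => sin p.1).
Proof. exact: (continuous_latitude (@continuous_sin R)). Qed.

Lemma continuous_row (T : topologicalType) n (f : T -> 'rV[R]_n) :
  (forall j, continuous (fun t => f t 0 j)) -> continuous f.
Proof.
move=> cf t A [P fP PA].
suff : \forall s \near t, forall j, P 0 j (f s 0 j).
  by apply: filterS => s Ps; apply: PA => i j; rewrite ord1.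
by apply: filter_forall => j; exact: cf (fP 0 j).
Qed.

Lemma dotE (x y : 'rV[R]_3) :
  dot x y = x 0 i0 * y 0 i0 + x 0 i1 * y 0 i1 + x 0 i2 * y 0 i2.
Proof.
rewrite /dot !big_ord_recr big_ord0/= add0r.
by congr (_ * _ + _ * _ + _ * _); congr (_ _ _); apply: val_inj.
Qed.

Lemma ord_maxE : ord_max = i2. Proof. exact: val_inj. Qed.

Lemma ord3P (P : 'I_3 -> Prop) : P i0 -> P i1 -> P i2 -> forall i, P i.
Proof.
move=> P0 P1 P2 [[|[|[|//]]] i].
- by rewrite (_ : Ordinal i = i0)//; exact: val_inj.
- by rewrite (_ : Ordinal i = i1)//; exact: val_inj.
- by rewrite (_ : Ordinal i = i2)//; exact: val_inj.
Qed.

Lemma continuous_spherical :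
  continuous (fun p : R * R => spherical p.1 p.2).
Proof.
have cc := continuous_latitude (@continuous_cos R).
have cs := continuous_latitude (@continuous_sin R).
have cc2 := continuous_longitude (@continuous_cos R).
have cs2 := continuous_longitude (@continuous_sin R).
apply: continuous_row; apply: ord3P => p.
- under eq_fun do rewrite mxE/=; apply: cvgM; [exact: cs|exact: cc2].
- under eq_fun do rewrite mxE/=; apply: cvgM; [exact: cs|exact: cs2].
- by under eq_fun do rewrite mxE/=; exact: cc.
Qed.

Definition spherical_dphi (x y : R) : 'rV[R]_3 :=
  \row_(i < 3) [:: cos x * cos y; cos x * sin y; - sin x]`_i.

Lemma continuous_spherical_dphi :
  continuous (fun p : R * R => spherical_dphi p.1 p.2).
Proof.
have cc := continuous_latitude (@continuous_cos R).
have cs := continuous_latitude (@continuous_sin R).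
have cc2 := continuous_longitude (@continuous_cos R).
have cs2 := continuous_longitude (@continuous_sin R).
apply: continuous_row; apply: ord3P => p.
- under eq_fun do rewrite mxE/=; apply: cvgM; [exact: cc|exact: cc2].
- under eq_fun do rewrite mxE/=; apply: cvgM; [exact: cc|exact: cs2].
- by under eq_fun do rewrite mxE/=; apply: cvgN; exact: cs.
Qed.

Lemma spherical_is_derive (x y : R) :
  is_derive x 1 (fun t => spherical t y) (spherical_dphi x y).
Proof.
have D i : is_derive x 1 (fun t => spherical t y 0 i) (spherical_dphi x y 0 i).
  move: i; apply: ord3P; rewrite !mxE/=; under eq_fun do rewrite mxE/=.
  - by apply: is_derive_eq; rewrite /GRing.scale/=; ring.
  - by apply: is_derive_eq; rewrite /GRing.scale/=; ring.
  - by apply: is_derive_eq.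
have dS : derivable (fun t => spherical t y) x 1.
  by apply/derivable_mxP => i j; rewrite ord1; have [] := D j.
apply: DeriveDef => //; rewrite derive_mx//; apply/rowP => j.
by rewrite [LHS]mxE derive_val.
Qed.

Lemma derive_along_meridian (f : 'rV[R]_3 -> R) (x y : R) :
  (forall z, differentiable f z) ->
  is_derive x 1 (fun t => f (spherical t y))
    (dot (grad f (spherical x y)) (spherical_dphi x y)).
Proof.
move=> df; have dS := spherical_is_derive x y.
have dS' : differentiable (fun t => spherical t y) x by apply/derivable1_diffP.
have dfS : differentiable (f \o (fun t => spherical t y)) x by exact: differentiable_comp.
apply: DeriveDef; first exact/derivable1_diffP.
rewrite deriveE// diff_comp//= -(deriveE (1 : R) dS') derive_val.
rewrite {1}(row_sum_delta (spherical_dphi x y)) linear_sum/=.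
apply: eq_bigr => i _; rewrite linearZ/= mulrC; congr (_ * _).
by rewrite mxE deriveE.
Qed.

Lemma grad_coordE (f : 'rV[R]_3 -> R) x i : grad f x 0 i = 'D_(delta_mx 0 i) f x.
Proof. by rewrite mxE. Qed.

Lemma C1_grad_continuous (f : 'rV[R]_3 -> R) : C1 f -> continuous (grad f).
Proof.
move=> [_ cf]; apply: continuous_row => j.
by under eq_fun do rewrite grad_coordE; exact: cf.
Qed.

Lemma C1_continuous (f : 'rV[R]_3 -> R) : C1 f -> continuous f.
Proof. by move=> [df _] x; exact: differentiable_continuous. Qed.

Lemma row_coord_continuous (T : topologicalType) n (f : T -> 'rV[R]_n) i :
  continuous f -> continuous (fun t => f t 0 i).
Proof.
move=> cf t; apply: (@continuous_comp _ _ _ f (fun M : 'rV[R]_n => M 0 i)).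
  exact: cf.
exact: coord_continuous.
Qed.

Lemma continuous_dot (T : topologicalType) (f g : T -> 'rV[R]_3) :
  continuous f -> continuous g -> continuous (fun t => dot (f t) (g t)).
Proof.
move=> cf cg; under eq_fun do rewrite dotE.
have cfi i : continuous (fun t => f t 0 i).
  exact: row_coord_continuous.
have cgi i : continuous (fun t => g t 0 i).
  exact: row_coord_continuous.
have cfg i : continuous (fun t => f t 0 i * g t 0 i).
  by move=> t; apply: cvgM; [exact: cfi|exact: cgi].
by move=> t; exact: (cvgD (cvgD (cfg _ t) (cfg _ t)) (cfg _ t)).
Qed.

Lemma spherical_on_sphere x y : sphere (spherical x y : 'rV[R]_3).
Proof.
rewrite /sphere/= dotE !mxE/=.
have := cos2Dsin2 x; have := cos2Dsin2 y; nra.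
Qed.

Lemma dot_tangential (x g k : 'rV[R]_3) : dot x x = 1 ->
  dot (g - dot g x *: x) (k - dot k x *: x) = dot g k - dot g x * dot k x.
Proof.
rewrite !dotE !mxE => h.
transitivity (dot g k - dot g x * dot k x * (2 - dot x x)); rewrite !dotE.
  by ring.
by rewrite h; ring.
Qed.

End Spherical.

(** * Functions of the height, and caps *)

Section Axisymmetric.
Variable R : realType.
Local Notation mu := (@lebesgue_measure R).
Local Notation plane := (measurableTypeR R * measurableTypeR R)%type.
Local Notation i0 := (@Ordinal 3 0 isT).
Local Notation i1 := (@Ordinal 3 1 isT).
Local Notation i2 := (@Ordinal 3 2 isT).

(** Integrating from 0 needs two pieces, since integrals are over sets: one of the
    two terms of [H] is always over an empty or trivial interval.  Near a given
    [x] this agrees, up to a constant, with the integral from a point far to the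
    left, to which the fundamental theorem of calculus applies. *)
Lemma continuous_primitive (h : R -> R) : continuous h ->
  exists H : R -> R, forall x : R, is_derive x 1 H (h x).
Proof.
move=> ch.
have ih a b : mu.-integrable `[a, b] (EFin \o h).
  apply: continuous_compact_integrable; first exact: segment_compact.
  exact: continuous_subspaceT.
have itvB a s t : a <= s -> s <= t -> \int[mu]_(r in `[s, t]) h r =
    \int[mu]_(r in `[a, t]) h r - \int[mu]_(r in `[a, s]) h r.
  move=> as_ st; rewrite Rintegral_itvB ?bnd_simp//.
  rewrite Rintegral_itv_obnd_cbnd//.
  apply: integrableS (ih s t) => //.
  by apply: subset_itvr; rewrite bnd_simp.
pose H (t : R) : R := \int[mu]_(r in `[0, t]) h r - \int[mu]_(r in `[t, 0]) h r.
exists H => x; pose M : R := `|x| + 1.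
have M0 : 0 < M by rewrite /M ltr_wpDl.
pose K (t : R) : R := \int[mu]_(r in `[(- M), t]) h r.
(* the two primitives differ by a constant near [x] *)
have HK : \forall t \near x, H t = K t - K 0.
  have xM : x \in `](- M), M[.
    by rewrite in_itv/= -ltr_norml /M ltrDl.
  near=> t.
  have : t \in `](- M), M[ by near: t; exact: near_in_itvoo xM.
  rewrite in_itv/= => /andP[Mt tM]; rewrite /H /K.
  have [t0|t0|<-] := ltgtP t 0.
  - rewrite (itvB (- M) t 0) ?ltW// [X in X - _](_ : _ = 0) ?sub0r ?opprB//.
    by rewrite set_itv_ge ?Rintegral_set0// bnd_simp -ltNge.
  - rewrite (itvB (- M) 0 t) ?ltW// ?oppr_lt0//.
    rewrite [X in _ - X](_ : _ = 0) ?subr0//.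
    by rewrite set_itv_ge ?Rintegral_set0// bnd_simp -ltNge.
  - by rewrite !set_itv1 !Rintegral_set1 !subrr.
have [dK K'] : derivable K x 1 /\ (K^`())%classic x = h x.
  apply: (@continuous_FTC1_closed _ h (- M) x M).
  - by rewrite /M (le_lt_trans (ler_norm x))// ltrDl.
  - exact: ih.
  - by have : `|x| < M by [rewrite /M ltrDl]; rewrite ltr_norml => /andP[].
  - exact: ch.
have dKc : is_derive x 1 (fun t => K t - K 0) (h x).
  have dK' : is_derive x 1 K (h x).
    by apply: DeriveDef; [exact: dK|rewrite -derive1E].
  by apply: is_derive_eq; rewrite subr0.
have [d1 d2] := dKc; apply: DeriveDef.
  by apply: near_eq_derivable d1; rewrite ?oner_eq0//; near do apply/esym.
rewrite -d2; apply: near_eq_derive => //; exact: oner_neq0.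
Unshelve. all: by end_near. Qed.

Section Height.
Variables (V h : R -> R).
Hypotheses (dV : forall x : R, is_derive x 1 V (h x)) (ch : continuous h).
Let v (x : 'rV[R]_3) := V (x 0 i2).

Lemma differentiable_height x : differentiable v x.
Proof.
apply: (@differentiable_comp _ _ _ _ (fun x : 'rV[R]_3 => x 0 i2) V).
  exact: differentiable_coord.
by apply/derivable1_diffP.
Qed.

Lemma derive_height (w x : 'rV[R]_3) : 'D_w v x = w 0 i2 * h (x 0 i2).
Proof.
have dc : differentiable (fun x : 'rV[R]_3 => x 0 i2) x.
  exact: differentiable_coord.
have dVx : differentiable V (x 0 i2) by apply/derivable1_diffP.
rewrite deriveE; last exact: differentiable_height.
rewrite (@diff_comp _ _ _ _ (fun x : 'rV[R]_3 => x 0 i2) V)//=.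
have -> : 'd (fun x : 'rV[R]_3 => x 0 i2) x w = w 0 i2 *: 1.
  rewrite [RHS]mulr1 -deriveE//.
  have := derive_mx (@derivable_id _ _ x w).
  by rewrite derive_id => /rowP/(_ i2); rewrite mxE.
by rewrite linearZ/= -deriveE// derive_val.
Qed.

Lemma C1_height : C1 v.
Proof.
split; first exact: differentiable_height.
have chx : continuous (fun x : 'rV[R]_3 => h (x 0 i2)).
  move=> x; apply: (@continuous_comp _ _ _ (fun x : 'rV[R]_3 => x 0 i2) h).
    exact: coord_continuous.
  exact: ch.
move=> w; under eq_fun do rewrite derive_height.
by move=> x; exact: (cvgM (cvg_cst (w 0 i2)) (chx x)).
Qed.

Lemma grad_height x : grad v x = h (x 0 i2) *: delta_mx 0 i2.
Proof.
apply/rowP => j; rewrite !mxE derive_height mulrC; congr (_ * _).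
by rewrite !mxE eqxx/= eq_sym.
Qed.

(** The gradient of a function of the height is tangent to the meridian, with
    component - h(cos x) sin x, so its product with the gradient of [f] only
    involves the derivative of [f] along the meridian.  The further factor sin x
    is the area density. *)
Lemma sphere_grad_height (f : 'rV[R]_3 -> R) x y :
  dot (sphere_grad v (spherical x y)) (sphere_grad f (spherical x y)) * sin x =
  - (h (cos x) * sin x ^+ 2 * dot (grad f (spherical x y)) (spherical_dphi x y)).
Proof.
rewrite dot_tangential; last exact: spherical_on_sphere.
rewrite grad_height !dotE !mxE/=.
move: ('D_'e_i0 _ _) ('D_'e_i1 _ _) ('D_'e_i2 _ _) => d0 d1 d2.
apply/eqP; rewrite -subr_eq0; apply/eqP.
transitivity (h (cos x) * d2 * sin x * (1 - (cos x ^+ 2 + sin x ^+ 2))).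
  by ring.
by rewrite cos2Dsin2 subrr mulr0.
Qed.
End Height.

Lemma continuous_on_sphere (T : topologicalType) (g : 'rV[R]_3 -> T) :
  continuous g -> continuous (fun p : R * R => g (spherical p.1 p.2)).
Proof.
move=> cg p.
apply: (@continuous_comp _ _ _ (fun p : R * R => spherical p.1 p.2) g).
  exact: continuous_spherical.
exact: cg.
Qed.

Definition meridian_deriv (f : 'rV[R]_3 -> R) (p : R * R) : R :=
  dot (grad f (spherical p.1 p.2)) (spherical_dphi p.1 p.2).

Lemma continuous_meridian_deriv f : C1 f -> continuous (meridian_deriv f).
Proof.
move=> Cf; apply: continuous_dot; last exact: continuous_spherical_dphi.
exact: continuous_on_sphere (C1_grad_continuous Cf).
Qed.

Lemma tame_step (a : R) : tame (fun p : plane => step a (cos p.1)).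
Proof.
apply: (tame_latitude (h := fun x => step a (cos x)) (C := 1)).
  apply: (measurableT_comp (f := step a)).
    apply: nondecreasing_measurable => // s t st; rewrite /step ler_nat.
    by case: (leP a s) => //= /le_trans/(_ st) ->.
  by apply: continuous_measurable_fun; exact: continuous_cos.
by move=> x _; rewrite /step; case: (a <= cos x)%R; rewrite ?normr1 ?normr0.
Qed.

Lemma continuous_ramp (a : R) : continuous (@ramp R a).
Proof.
apply: max_fun_continuous => t; first exact: cvg_cst.
by apply: cvgB; [exact: cvg_id|exact: cvg_cst].
Qed.

Lemma continuous_weighted_on_sphere f :
  C1 f -> continuous (fun p : R * R => f (spherical p.1 p.2) * sin p.1).
Proof.
move=> Cf p; apply: cvgM; last exact: continuous_sin_polar.
exact: (continuous_on_sphere (C1_continuous Cf)).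
Qed.

Lemma continuous_ramp_meridian a f : C1 f ->
  continuous (fun p : R * R => ramp a (cos p.1) * meridian_deriv f p).
Proof.
move=> Cf p; apply: cvgM; last exact: continuous_meridian_deriv.
apply: (continuous_latitude (g := fun x => ramp a (cos x))) => x.
apply: (@continuous_comp _ _ _ cos (ramp a)); first exact: continuous_cos.
exact: continuous_ramp.
Qed.

Lemma C1_one : C1 (fun=> 1 : R).
Proof.
split=> [x|w]; first exact: differentiable_cst.
by under eq_fun do rewrite derive_cst; exact: cst_continuous.
Qed.

Lemma meridian_deriv_one p : meridian_deriv (fun=> 1) p = 0.
Proof.
by rewrite /meridian_deriv /dot big1// => i _; rewrite mxE derive_cst mul0r.
Qed.

Lemma north_pole y : spherical 0 y = spherical 0 0 :> 'rV[R]_3.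
Proof. by apply/rowP; apply: ord3P; rewrite !mxE/= ?sin0 ?mul0r. Qed.

(** Fubini reduces this to [cap_by_parts] on each meridian; the boundary terms all
    sit at the north pole. *)
Lemma cap_identity (a : R) (f : 'rV[R]_3 -> R) : -1 <= a <= 1 -> C1 f ->
  polar_integral (fun p => step a (cos p.1) * (f (spherical p.1 p.2) * sin p.1)) =
  polar_integral (fun p => ramp a (cos p.1) * meridian_deriv f p) +
  2 * pi * (1 - a) * f (spherical 0 0).
Proof.
move=> aI Cf.
have c1 := continuous_weighted_on_sphere Cf.
have c2 := continuous_ramp_meridian (a := a) Cf.
have t1 : tame (fun p => step a (cos p.1) * (f (spherical p.1 p.2) * sin p.1)).
  by apply: tameM; [exact: tame_step|exact: tame_continuous].
have t2 : tame (fun p => ramp a (cos p.1) * meridian_deriv f p).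
  exact: tame_continuous.
apply/eqP; rewrite addrC -subr_eq -polar_integralB//; apply/eqP.
have [m12 [C bC]] := tameB t1 t2.
rewrite /polar_integral (polar_fubini m12 bC).
transitivity (\int[mu]_(y in `[0, 2 * pi]) ((1 - a) * f (spherical 0 0))).
  apply: (@eq_Rintegral _ _ _ mu) => y _.
  rewrite -(north_pole y) -(cap_by_parts aI _ (fun x => derive_along_meridian x y Cf.1)).
    by apply: (@eq_Rintegral _ _ _ mu) => x _ /=; rewrite /meridian_deriv; ring.
  move=> x; apply: (@continuous_comp _ _ _ (fun x : R => (x, y)) (meridian_deriv f)).
    move=> A [[P Q] /= [xP yQ] PQA]; apply: filterS xP => t Pt.
    by apply: PQA; split=> //; exact: nbhs_singleton.
  exact: continuous_meridian_deriv.
rewrite Rintegral_cst//= lebesgue_segment ?mulr_ge0 ?pi_ge0//= subr0.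
by ring.
Qed.

End Axisymmetric.

(** * Patterns as alternating sums of caps *)

Section Pattern.
Variable R : realType.
Local Notation plane := (measurableTypeR R * measurableTypeR R)%type.

Fixpoint alternating (Phi : R -> R) (s : seq R) : R :=
  if s is a :: s' then Phi a - alternating Phi s' else 0.

Lemma alternating_cat Phi s1 s2 : alternating Phi (s1 ++ s2) =
  alternating Phi s1 + (-1) ^+ size s1 * alternating Phi s2.
Proof.
elim: s1 => [|a s1 IH] /=; first by rewrite add0r mul1r.
by rewrite IH exprS; ring.
Qed.

Lemma alternating_rev Phi s :
  alternating Phi (rev s) = - ((-1) ^+ size s * alternating Phi s).
Proof.
elim: s => [|a s IH]; first by rewrite /= mulr0 oppr0.
rewrite rev_cons -cats1 alternating_cat IH size_rev /= exprS; ring.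
Qed.

Lemma alternating_map Phi g s :
  alternating Phi (map g s) = alternating (Phi \o g) s.
Proof. by elim: s => //= a s ->. Qed.

Lemma alternatingE Phi s :
  alternating Phi s = \sum_(i < size s) (-1) ^+ i * Phi s`_i.
Proof.
elim: s => [|a s IH]; first by rewrite big_ord0.
rewrite /= big_ord_recl/= expr0 mul1r IH; congr (_ + _).
rewrite -sumrN; apply: eq_bigr => i _.
by rewrite /bump/= add1n exprS mulN1r mulNr.
Qed.

(** In an increasing list the elements below [t] come first, so the alternating
    sum of their indicators is 1 or 0 according to the parity of their number. *)
Lemma sign_count_sorted (t : R) s : sorted <=%R s ->
  (-1) ^+ count (fun a => a <= t)%R s = 1 - 2 * alternating (fun a => step a t) s :> R.
Proof.
elim: s => [_|a s IH /= ps]; first by rewrite /= mulr0 subr0.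
have {IH} := IH (path_sorted ps).
have {ps} := order_path_min le_trans ps.
rewrite exprD /step; case: (leP a t) => [at_ _ ->|ta sa _] /=.
  by rewrite expr1; ring.
have tall b : b \in s -> (b <= t) = false.
  by move=> /(allP sa) ab; apply/negbTE; rewrite -ltNge (lt_le_trans ta).
have -> : count (fun a => a <= t) s = 0%N.
  by apply/eqP; rewrite -leqn0 leqNgt -has_count; apply/hasPn => b /tall ->.
rewrite (_ : alternating _ s = 0); first by rewrite !expr0; ring.
elim: s {sa} tall => //= b s IH tall.
by rewrite tall ?inE ?eqxx//= IH ?subr0// => c cs; rewrite tall// inE cs orbT.
Qed.

(** The alternating sum over all 2n symmetric interfaces, with the two members of
    each pair collected; twice [alternating] by [alternating_interfaces]. *)
Definition alt_sum n (z : 'rV[R]_n) (Phi : R -> R) : R :=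
  2 * (-1) ^+ n * \sum_(i < n) (-1) ^+ i * (Phi (z 0 i) - Phi (- z 0 i)).

Section AltSum.
Variables (n : nat) (z : 'rV[R]_n).

Lemma alternating_interfaces Phi :
  2 * alternating Phi (symmetric_interfaces z) = alt_sum z Phi.
Proof.
rewrite /symmetric_interfaces alternating_cat alternating_map alternating_rev.
have sz : size [seq z 0 i | i <- enum 'I_n] = n.
  by rewrite size_map size_enum_ord.
rewrite [size (map _ (rev _))]size_map size_rev sz.
have E Psi : alternating Psi [seq z 0 i | i <- enum 'I_n] =
    \sum_(i < n) (-1) ^+ i * Psi (z 0 i).
  rewrite alternatingE sz; apply: eq_bigr => i _.
  by rewrite (nth_map i) ?size_enum_ord// nth_ord_enum.
rewrite !E /alt_sum.
under [X in _ = _ * X]eq_bigr do rewrite mulrBr.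
by rewrite sumrB/=; ring.
Qed.

Lemma alt_sumZ c Phi : alt_sum z (fun a => c * Phi a) = c * alt_sum z Phi.
Proof.
rewrite /alt_sum [RHS]mulrCA; congr (_ * _); rewrite mulr_sumr.
by apply: eq_bigr => i _; ring.
Qed.

Lemma alt_sumB Phi Psi :
  alt_sum z (fun a => Phi a - Psi a) = alt_sum z Phi - alt_sum z Psi.
Proof.
rewrite /alt_sum -mulrBr -sumrB; congr (_ * _).
by apply: eq_bigr => i _; ring.
Qed.

Lemma eq_alt_sum Phi Psi : (forall i, Phi (z 0 i) = Psi (z 0 i)) ->
  (forall i, Phi (- z 0 i) = Psi (- z 0 i)) -> alt_sum z Phi = alt_sum z Psi.
Proof. by move=> e1 e2; congr (_ * _); apply: eq_bigr => i _; rewrite e1 e2. Qed.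

(** This is the mass constraint.  It has the effect that all boundary terms at the
    poles cancel in the sequel, because 1 - a measures the area of the cap above
    [a]. *)
Lemma alt_sum_defect : Mset z -> alt_sum z (fun a => 1 - a) = 2.
Proof.
rewrite /Mset/= => zM; rewrite /alt_sum.
transitivity (4 * (-1) ^+ n * \sum_(i < n) (-1) ^+ i.+1 * z 0 i).
  rewrite !mulr_sumr; apply: eq_bigr => i _.
  by rewrite exprS; ring.
rewrite zM; transitivity (2 * ((-1) ^+ n) ^+ 2 : R); first by field.
by rewrite sqrr_sign mulr1.
Qed.

Lemma tame_alt_sum (g : R -> plane -> R) : (forall a, tame (g a)) ->
  tame (fun p => alt_sum z (fun a => g a p)).
Proof.
move=> tg; apply: tameZ; apply: tame_sum => i; apply: tameZ.
by apply: tameB; exact: tg.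
Qed.

Lemma polar_integral_alt_sum (g : R -> plane -> R) : (forall a, tame (g a)) ->
  polar_integral (fun p => alt_sum z (fun a => g a p)) =
  alt_sum z (fun a => polar_integral (g a)).
Proof.
move=> tg; rewrite polar_integralZ; last first.
  by apply: tame_sum => i; apply: tameZ; apply: tameB; exact: tg.
congr (_ * _); rewrite polar_integral_sum; last first.
  by move=> i; apply: tameZ; apply: tameB; exact: tg.
apply: eq_bigr => i _; rewrite polar_integralZ ?polar_integralB//.
exact: tameB.
Qed.

End AltSum.

Lemma symmetric_interfaces_sorted n (z : 'rV[R]_n) :
  (forall i, 0 <= z 0 i) -> (forall i j : 'I_n, (i < j)%N -> z 0 i <= z 0 j) ->
  sorted <=%R (symmetric_interfaces z).
Proof.
move=> z0 zm; rewrite /symmetric_interfaces.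
set s := [seq z 0 i | i <- enum 'I_n].
have ss : sorted <=%R s.
  have : sorted ltn (map val (enum 'I_n)) by rewrite val_enum_ord iota_ltn_sorted.
  by rewrite /s !sorted_map; apply: sub_sorted => i j /=; exact: zm.
rewrite (sorted_pairwise le_trans) pairwise_cat.
apply/and3P; split.
- apply/allrelP => _ _ /mapP[a + ->] /mapP[j _ ->].
  rewrite mem_rev => /mapP[i _ ->].
  by rewrite (le_trans _ (z0 j))// oppr_le0.
- rewrite -(sorted_pairwise le_trans) sorted_map rev_sorted.
  by apply: sub_sorted ss => a b /=; rewrite lerN2.
- by rewrite -(sorted_pairwise le_trans).
Qed.

(** The sign of a pattern jumps by 2 or -2 at each interface, starting from -1 at
    the south pole. *)
Lemma patternE n (z : 'rV[R]_n) x :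
  (forall i, 0 <= z 0 i) -> (forall i j : 'I_n, (i < j)%N -> z 0 i <= z 0 j) ->
  axisymmetric_pattern (symmetric_interfaces z) x =
  alt_sum z (fun a => step a (x 0 ord_max)) - 1.
Proof.
move=> z0 zm; rewrite /axisymmetric_pattern exprS.
rewrite sign_count_sorted; last exact: symmetric_interfaces_sorted.
by rewrite alternating_interfaces; ring.
Qed.

End Pattern.

(** * The potential of a pattern and its energy *)

Section Potential.
Variable R : realType.
Local Notation plane := (measurableTypeR R * measurableTypeR R)%type.
Local Notation i2 := (@Ordinal 3 2 isT).

Lemma continuous_sum (T : topologicalType) (I : Type) (s : seq I) (F : I -> T -> R) :
  (forall i, continuous (F i)) -> continuous (fun t => \sum_(i <- s) F i t).
Proof. by move=> cF; apply: continuous_big => //; exact: add_continuous. Qed.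

Lemma dotC (x y : 'rV[R]_3) : dot x y = dot y x.
Proof. by apply: eq_bigr => i _; rewrite mulrC. Qed.

(** Testing the weak equation of either solution with the other one, the symmetry
    of the Dirichlet form shows that all solutions have the same energy. *)
Lemma potential_energy (u v : 'rV[R]_3 -> R) : poisson_solution u v ->
  sphere_integral (fun x =>
    dot (sphere_grad (potential u) x) (sphere_grad (potential u) x)) =
  sphere_integral (fun x => dot (sphere_grad v x) (sphere_grad v x)).
Proof.
move=> uv; have : poisson_solution u (potential u).
  by rewrite /potential; case: xgetP => [w _ //|/(_ v)]; exact.
case: uv => Cv vP; move: (potential u) => w [Cw wP].
have sym := f_equal (@sphere_integral R)
  (funext (fun x => dotC (sphere_grad v x) (sphere_grad w x))).
exact: (etrans (wP _ Cw) (etrans (esym (vP _ Cw))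
  (etrans sym (etrans (wP _ Cv) (esym (vP _ Cv)))))).
Qed.

(** Minus the derivative, as a function of the height, of the potential of the cap
    above [a].  The field times 1 - t^2 is the ramp of the cap corrected by a
    linear term (see [cap_fieldE]), so on either side of [a] a factor 1 - t or
    1 + t cancels; the formula with min and max joins both sides into a function
    that is continuous on the whole line if -1 < a < 1. *)
Definition cap_field (a t : R) : R :=
  - 2^-1 * ((1 - a) / (1 - Num.min t a) + (1 + a) / (1 + Num.max t a) - 1).

Lemma cap_fieldE a t : -1 < a < 1 -> -1 <= t <= 1 ->
  cap_field a t * (1 - t ^+ 2) = ramp a t - (1 - a) / 2 * (t + 1).
Proof.
move=> /andP[a1 a2] /andP[t1 t2]; rewrite /cap_field /ramp.
have [at_|ta] := leP a t.
  rewrite max_r ?subr_ge0//; field.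
  by apply/andP; split; apply/lt0r_neq0; lra.
rewrite max_l ?subr_le0 ?ltW//; field.
by apply/andP; split; apply/lt0r_neq0; lra.
Qed.

Lemma continuous_cap_field a : -1 < a < 1 -> continuous (cap_field a).
Proof.
move=> /andP[a1 a2].
have cm : continuous (fun t : R => Num.min t a).
  by apply: min_fun_continuous => t; [exact: cvg_id|exact: cvg_cst].
have cM : continuous (fun t : R => Num.max t a).
  by apply: max_fun_continuous => t; [exact: cvg_id|exact: cvg_cst].
move=> t; apply: cvgM; first exact: cvg_cst.
apply: cvgB; last exact: cvg_cst.
apply: cvgD; apply: cvgM; [exact: cvg_cst| |exact: cvg_cst| ]; apply: cvgV.
- by apply/lt0r_neq0; have : Num.min t a <= a by [rewrite ge_min lexx orbT]; lra.
- by apply: cvgB; [exact: cvg_cst|exact: cm].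
- by apply/lt0r_neq0; have : a <= Num.max t a by [rewrite le_max lexx orbT]; lra.
- by apply: cvgD; [exact: cvg_cst|exact: cM].
Qed.

(** The integral of the pattern over the heights between -1 and [t]; see
    [patternE]. *)
Definition moment n (z : 'rV[R]_n) (t : R) : R :=
  alt_sum z (fun a => ramp a t) - (t + 1).

Definition pattern_field n (z : 'rV[R]_n) (t : R) : R :=
  - alt_sum z (fun a => cap_field a t).

Section Balanced.
Variables (n : nat) (z : 'rV[R]_n).
Hypotheses (zM : Mset z) (zZ : Zset z).
Let u := axisymmetric_pattern (symmetric_interfaces z).

Let z01 i : -1 < z 0 i < 1.
Proof. by case: zZ => z0 _ z1; rewrite z1 (lt_trans _ (z0 i)). Qed.

Let zN01 i : -1 < - z 0 i < 1.
Proof. by rewrite ltrN2 ltrNl andbC z01. Qed.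

Lemma continuous_pattern_field : continuous (pattern_field z).
Proof.
have cs : continuous (fun t => \sum_(i < n)
    (-1) ^+ i * (cap_field (z 0 i) t - cap_field (- z 0 i) t)).
  apply: continuous_sum => i t; apply: cvgM; first exact: cvg_cst.
  by apply: cvgB; exact: continuous_cap_field.
by move=> t; apply: cvgN; apply: cvgM; [exact: cvg_cst|exact: cs].
Qed.

(** The linear corrections in [cap_fieldE] add up to t + 1 by the mass
    constraint, which is what [moment] subtracts. *)
Lemma pattern_fieldE t : -1 <= t <= 1 ->
  pattern_field z t * (1 - t ^+ 2) = - moment z t.
Proof.
move=> tI; rewrite mulNr mulrC -alt_sumZ; congr (- _).
rewrite (@eq_alt_sum _ _ _ _ (fun a => ramp a t - (t + 1) / 2 * (1 - a))).
- by rewrite alt_sumB alt_sumZ alt_sum_defect//; rewrite /moment; field.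
- by move=> i; rewrite mulrC cap_fieldE//; field.
- by move=> i; rewrite mulrC cap_fieldE//; field.
Qed.

Lemma cos_itv (x : R) : -1 <= cos x <= 1.
Proof. by rewrite cos_geN1 cos_le1. Qed.

Lemma pattern_field_cos x :
  pattern_field z (cos x) * sin x ^+ 2 = - moment z (cos x).
Proof.
rewrite -(pattern_fieldE (cos_itv x)); congr (_ * _).
by rewrite -(cos2Dsin2 x); ring.
Qed.

(** [cap_identity] applied to each cap of the pattern and to the whole sphere,
    which is the cap above height -1.  The terms at the north pole cancel by the
    mass constraint. *)
Lemma pattern_integral f : C1 f ->
  sphere_integral (fun x => u x * f x) =
  polar_integral (fun p => moment z (cos p.1) * meridian_deriv f p).
Proof.
move=> Cf; case: zZ => z0 zm z1.
have c1 := continuous_weighted_on_sphere Cf.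
pose K a := fun p : plane => step a (cos p.1) * (f (spherical p.1 p.2) * sin p.1).
pose J a := fun p : plane => ramp a (cos p.1) * meridian_deriv f p.
have tK a : tame (K a) by apply: tameM; [exact: tame_step|exact: tame_continuous].
have tJ a : tame (J a).
  by apply: tame_continuous; exact: continuous_ramp_meridian.
have KJ a : -1 <= a <= 1 -> polar_integral (K a) =
    polar_integral (J a) - - (2 * pi * f (spherical 0 0)) * (1 - a).
  by move=> aI; rewrite /K cap_identity// /J; ring.
transitivity (polar_integral (fun p => alt_sum z (fun a => K a p) - K (-1) p)).
  apply: eq_Rintegral => p _; rewrite /u patternE;
    [|by move=> i; exact/ltW|by move=> i j ij; exact/ltW/zm].
  rewrite ord_maxE mxE/= /K.
  rewrite (_ : step (-1) (cos p.1) = 1) ?mul1r; last first.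
    by rewrite /step cos_geN1.
  rewrite -mulrA mulrBl mul1r [X in X - _]mulrC -alt_sumZ; congr (_ - _).
  by apply: eq_alt_sum => i; rewrite mulrC.
transitivity (polar_integral (fun p => alt_sum z (fun a => J a p) - J (-1) p)).
  rewrite !polar_integralB//; [|exact: tame_alt_sum|exact: tame_alt_sum].
  rewrite !polar_integral_alt_sum//.
  rewrite (@eq_alt_sum _ _ _ _ (fun a => polar_integral (J a) -
      - (2 * pi * f (spherical 0 0)) * (1 - a))); last 2 first.
  - by move=> i; apply: KJ; have /andP[/ltW -> /ltW] := z01 i.
  - by move=> i; apply: KJ; have /andP[/ltW -> /ltW] := zN01 i.
  rewrite alt_sumB alt_sumZ alt_sum_defect// KJ ?lexx ?lerN10//; last first.
    by rewrite (@le_trans _ _ 0) ?lerN10.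
  by ring.
apply: eq_polar_integral => p _; rewrite /moment /J mulrBl; congr (_ - _).
  by rewrite [RHS]mulrC -alt_sumZ; apply: eq_alt_sum => i; rewrite mulrC.
by rewrite /ramp opprK max_r// -lerBlDr sub0r cos_geN1.
Qed.

(** The potential is a primitive of [pattern_field] in the height.  Testing its
    equation with the constant 1 shows that the pattern has mean 0. *)
Lemma pattern_poisson : exists2 v, poisson_solution u v &
  sphere_integral (fun x => dot (sphere_grad v x) (sphere_grad v x)) =
  polar_integral (fun p => moment z (cos p.1) ^+ 2 / sin p.1).
Proof.
have [V dV] := continuous_primitive continuous_pattern_field.
pose v (x : 'rV[R]_3) := V (x 0 i2).
have flux (f : 'rV[R]_3 -> R) (p : R * R) :
    dot (sphere_grad v (spherical p.1 p.2)) (sphere_grad f (spherical p.1 p.2))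
      * sin p.1 = moment z (cos p.1) * meridian_deriv f p.
  by rewrite (sphere_grad_height dV) pattern_field_cos mulNr opprK.
have Cv : C1 v := C1_height dV continuous_pattern_field.
have weak f : C1 f ->
    sphere_integral (fun x => dot (sphere_grad v x) (sphere_grad f x)) =
    sphere_integral (fun x => u x * f x).
  move=> Cf; rewrite pattern_integral//.
  by apply: eq_Rintegral => p _; rewrite flux.
have mean0 : sphere_mean u = 0.
  rewrite /sphere_mean (_ : sphere_integral u = 0) ?mulr0//.
  transitivity (sphere_integral (fun x => u x * 1)).
    by apply: eq_Rintegral => p _; rewrite mulr1.
  rewrite (pattern_integral (C1_one R)).
  transitivity (polar_integral (fun=> 0 : R)); last first.
    by rewrite polar_integral_cst mul0r.
  by apply: eq_polar_integral => p _; rewrite meridian_deriv_one mulr0.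
exists v.
  split=> // f Cf; rewrite weak// mean0.
  by congr sphere_integral; apply/funext => x; rewrite subr0.
apply: eq_Rintegral => p _; rewrite flux.
rewrite /meridian_deriv (grad_height dV) dotE !mxE/= !mulr0 !mul0r !add0r mulr1.
have -> : moment z (cos p.1) = - (pattern_field z (cos p.1) * sin p.1 ^+ 2).
  by rewrite pattern_field_cos opprK.
have [->|s0] := eqVneq (sin p.1) 0; first by rewrite oppr0 !mulr0 invr0 mulr0.
by field.
Qed.

End Balanced.

Lemma balanced_pattern_energy n (gamma : R) (z : 'rV[R]_n) : Mset z -> Zset z ->
  pattern_energy gamma z =
  ((2^-1)%:E * total_variation_sphere (axisymmetric_pattern (symmetric_interfaces z))
   + (gamma * polar_integral (fun p => moment z (cos p.1) ^+ 2 / sin p.1))%:E)%E.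
Proof.
move=> zM zZ; have [v uv vE] := pattern_poisson zM zZ.
pose E D : \bar R := ((2^-1)%:E * total_variation_sphere
  (axisymmetric_pattern (symmetric_interfaces z)) + (gamma * D)%:E)%E.
exact: (etrans (f_equal E (potential_energy uv)) (f_equal E vE)).
Qed.

End Potential.

(** * Lower semicontinuity of the perimeter *)

Section Caps.
Variable R : realType.
Local Notation plane := (measurableTypeR R * measurableTypeR R)%type.

Lemma tame_cap (a : R) (k : R * R -> R) : continuous k ->
  tame (fun p : plane => step a (cos p.1) * k p).
Proof. by move=> ck; apply: tameM; [exact: tame_step|exact: tame_continuous]. Qed.

(** Archimedes: the area of a cap is proportional to its height. *)
Lemma cap_area (a : R) : -1 <= a <= 1 ->
  polar_integral (fun p => step a (cos p.1) * sin p.1) = 2 * pi * (1 - a).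
Proof.
move=> aI.
transitivity (polar_integral (fun p => step a (cos p.1) * (1 * sin p.1))).
  by apply: eq_polar_integral => p _; rewrite mul1r.
rewrite (cap_identity aI (C1_one R)) mulr1 (_ : polar_integral _ = 0) ?add0r//.
transitivity (polar_integral (fun=> 0 : R)); last first.
  by rewrite polar_integral_cst mul0r.
by apply: eq_polar_integral => p _; rewrite meridian_deriv_one mulr0.
Qed.

Lemma polar_sin_ge0 (p : plane) : polar_rect p -> 0 <= sin p.1.
Proof. by move=> [/= + _]; rewrite in_itv/=; exact: sin_ge0_pi. Qed.

Lemma le_step (a b t : R) : a <= b -> step b t <= step a t.
Proof.
by move=> ab; rewrite /step ler_nat; case: (leP b t) => //= /(le_trans ab) ->.
Qed.

Section CapIntegral.
Variables (d : R * R -> R) (cd : continuous d).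

Definition cap_integral (a : R) : R :=
  polar_integral (fun p => step a (cos p.1) * (d p * sin p.1)).

Let cds : continuous (fun p : R * R => d p * sin p.1).
Proof. by move=> p; apply: cvgM; [exact: cd|exact: continuous_sin_polar]. Qed.

(** The integrals over two caps differ by an integral over the zone between them,
    whose area is proportional to |a - b| by [cap_area]. *)
Lemma cap_integral_lipschitz : exists C : R, forall a b,
  -1 <= a <= 1 -> -1 <= b <= 1 ->
  `|cap_integral a - cap_integral b| <= C * `|a - b|.
Proof.
have [_ [C dC]] := tame_continuous cd.
exists (C * (2 * pi)) => a b.
wlog ab : a b / a <= b.
  move=> W aI bI; have [ab|/ltW ba] := leP a b; first exact: W.
  by rewrite distrC [`|a - b|]distrC W.
move=> aI bI; rewrite /cap_integral -polar_integralB; [|exact: tame_cap..].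
apply: le_trans (le_norm_polar_integral _) _.
  by apply: tameB; exact: tame_cap.
have -> : C * (2 * pi) * `|a - b| =
    polar_integral (fun p =>
      C * (step a (cos p.1) * sin p.1 - step b (cos p.1) * sin p.1)).
  have t c : tame (fun p : plane => step c (cos p.1) * sin p.1).
    by apply: tame_cap; exact: continuous_sin_polar.
  rewrite polar_integralZ; last exact: tameB.
  rewrite polar_integralB// !cap_area// distrC ger0_norm ?subr_ge0//.
  by ring.
apply: le_polar_integral.
- by apply/tame_norm/tameB; exact: tame_cap.
- by apply/tameZ/tameB; apply: tame_cap; exact: continuous_sin_polar.
move=> p pR; rewrite -mulrBl -mulrBl normrM normrM.
rewrite ger0_norm ?subr_ge0 ?le_step// (ger0_norm (polar_sin_ge0 pR)).
rewrite mulrCA ler_pM ?mulr_ge0 ?subr_ge0 ?le_step ?polar_sin_ge0 ?dC//.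
Qed.

(** Used to extend [cap_integral] to a function that is continuous on the whole
    line. *)
Definition clamp (a : R) : R := Num.max (-1) (Num.min a 1).

Lemma clampI a : -1 <= clamp a <= 1.
Proof.
by rewrite /clamp le_max lexx/= ge_max ge_min lexx orbT (le_trans (lerN10 R) ler01).
Qed.

Lemma clamp_id a : -1 <= a <= 1 -> clamp a = a.
Proof. by move=> /andP[a1 a2]; rewrite /clamp min_l// max_r. Qed.

Lemma continuous_clamp : continuous clamp.
Proof.
apply: max_fun_continuous; first by move=> t; exact: cvg_cst.
by apply: min_fun_continuous => t; [exact: cvg_id|exact: cvg_cst].
Qed.

Lemma continuous_cap_integral : continuous (fun a => cap_integral (clamp a)).
Proof.
have [C lip] := cap_integral_lipschitz.
move=> a; apply/cvgrPdist_le => e e0.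
pose D := `|C| + 1.
have D0 : 0 < D by rewrite /D ltr_wpDl.
have : \forall b \near a, `|clamp a - clamp b| <= e / D.
  by have /cvgrPdist_le := @continuous_clamp a; apply; exact: divr_gt0.
apply: filterS => b ab.
apply: le_trans (lip _ _ (clampI a) (clampI b)) _.
apply: (@le_trans _ _ (D * (e / D))); last by rewrite mulrC divfK ?lt0r_neq0.
apply: (@le_trans _ _ (D * `|clamp a - clamp b|)).
  by rewrite ler_wpM2r// /D (le_trans (ler_norm C))// lerDl.
by rewrite ler_wpM2l// ltW.
Qed.

End CapIntegral.

Lemma continuous_sphere_div (X : 'rV[R]_3 -> 'rV[R]_3) :
  (forall i, C1 (fun y => X y 0 i)) -> continuous (sphere_div X).
Proof.
move=> XC; apply: continuous_sum => i.
have cg := C1_grad_continuous (XC i).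
have cid : continuous (@id 'rV[R]_3) by move=> x; exact: cvg_id.
have cdot := continuous_dot cg cid.
have entry (c : R) (g x : 'rV[R]_3) : (g - c *: x) 0 i = g 0 i - c * x 0 i.
  by rewrite !mxE.
under eq_fun do rewrite entry.
have c1 := row_coord_continuous (i := i) cg; have c2 := row_coord_continuous (i := i) cid.
by move=> x; exact: (cvgB (c1 x) (cvgM (cdot x) (c2 x))).
Qed.

End Caps.

Section TotalVariation.
Variable R : realType.

(** For a fixed vector field the functional in the definition of the total
    variation is an alternating sum of integrals over caps.  It agrees with a
    function continuous on all vectors [z], at those [z] that list interfaces in
    weakly increasing order. *)
Lemma tested_pattern_continuous n (X : 'rV[R]_3 -> 'rV[R]_3) :
  admissible_field X -> exists2 Q : 'rV[R]_n -> R, continuous Q &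
  forall z : 'rV[R]_n, (forall i, 0 <= z 0 i <= 1) ->
    (forall i j : 'I_n, (i < j)%N -> z 0 i <= z 0 j) ->
    Q z = sphere_integral (fun x =>
      axisymmetric_pattern (symmetric_interfaces z) x * sphere_div X x).
Proof.
move=> [XC _]; have cdiv := continuous_sphere_div XC.
pose d (p : R * R) := sphere_div X (spherical p.1 p.2).
have cd : continuous d by exact: continuous_on_sphere.
pose Q (z : 'rV[R]_n) := alt_sum z (fun a => cap_integral d (clamp a)) -
  cap_integral d (-1).
have cc := continuous_cap_integral cd.
have ce (i : 'I_n) : continuous (fun z : 'rV[R]_n => z 0 i).
  by move=> z; exact: coord_continuous.
have c1 (i : 'I_n) :
    continuous (fun z : 'rV[R]_n => cap_integral d (clamp (z 0 i))).
  move=> z; apply: (@continuous_comp _ _ _ (fun z : 'rV[R]_n => z 0 i)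
    (fun a => cap_integral d (clamp a))); [exact: ce|exact: cc].
have c2 (i : 'I_n) :
    continuous (fun z : 'rV[R]_n => cap_integral d (clamp (- z 0 i))).
  move=> z; apply: (@continuous_comp _ _ _ (fun z : 'rV[R]_n => - z 0 i)
    (fun a => cap_integral d (clamp a))); last exact: cc.
  exact: (cvgN (ce i z)).
exists Q.
  have cs : continuous (fun z : 'rV[R]_n => \sum_(i < n) (-1) ^+ i *
      (cap_integral d (clamp (z 0 i)) - cap_integral d (clamp (- z 0 i)))).
    apply: continuous_sum => i z.
    exact: (cvgM (cvg_cst ((-1) ^+ i : R)) (cvgB (c1 i z) (c2 i z))).
  move=> z; exact: (cvgB (cvgM (cvg_cst (2 * (-1) ^+ n : R)) (cs z))
                         (cvg_cst (cap_integral d (-1)))).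
move=> z zI zm.
have cds : continuous (fun p : R * R => d p * sin p.1).
  by move=> p; apply: cvgM; [exact: cd|exact: continuous_sin_polar].
have zc i : -1 <= z 0 i <= 1.
  by have /andP[z0 ->] := zI i; rewrite (le_trans (lerN10 R)).
have zNc i : -1 <= - z 0 i <= 1 by rewrite lerN2 lerNl andbC zc.
rewrite /Q (@eq_alt_sum _ _ _ _ (cap_integral d)); last 2 first.
- by move=> i; rewrite clamp_id.
- by move=> i; rewrite clamp_id.
rewrite -polar_integral_alt_sum; last by move=> a; exact: tame_cap.
rewrite -polar_integralB; [|by apply: tame_alt_sum => a; exact: tame_cap|exact: tame_cap].
apply: eq_polar_integral => p _; rewrite patternE//; last first.
  by move=> i; have /andP[] := zI i.
rewrite ord_maxE mxE/= (_ : step (-1) (cos p.1) = 1); last first.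
  by rewrite /step cos_geN1.
rewrite -mulrA mulrBl -/(d p); congr (_ - _).
by rewrite [RHS]mulrC -alt_sumZ; apply: eq_alt_sum => i; rewrite mulrC.
Qed.

Lemma total_variation_ge0 (u : 'rV[R]_3 -> R) : (0 <= total_variation_sphere u)%E.
Proof.
have e0 i : (fun=> (0 : 'rV[R]_3) 0 i) = cst 0 :> ('rV[R]_3 -> R).
  by apply/funext => y; rewrite mxE.
apply: ereal_sup_ubound; exists (fun=> 0).
  split=> [i|x _]; last by rewrite !dotE !mxE !(mul0r, addr0) ler01.
  rewrite e0; split=> [x|w]; first exact: differentiable_cst.
  by under eq_fun do rewrite derive_cst; exact: cst_continuous.
congr EFin; transitivity (polar_integral (fun=> 0 : R)); last first.
  by rewrite polar_integral_cst mul0r.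
apply: eq_polar_integral => p _.
rewrite /sphere_div big1 ?mulr0 ?mul0r// => i _; rewrite e0.
have g0 x : grad (cst 0 : 'rV[R]_3 -> R) x = 0.
  by apply/rowP => j; rewrite !mxE derive_cst.
by rewrite /sphere_grad !g0 /dot big1 ?scale0r ?subr0 ?mxE// => j _; rewrite mxE mul0r.
Qed.

End TotalVariation.

(** * Tents and their weighted energy *)

Section Tent.
Variable R : realType.

Definition tent (a b t : R) : R := Num.max 0 (Num.min (t - a) (b - t)).

Lemma tent_ge0 a b t : 0 <= tent a b t.
Proof. by rewrite /tent le_max lexx. Qed.

Lemma tent_le a b t : b <= 1 -> t <= 1 -> tent a b t <= 1 - t.
Proof.
move=> b1 t1; rewrite /tent ge_max subr_ge0 t1/= ge_min lerD2r b1 orbT.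
by [].
Qed.

Lemma tent_ramp a b t : a <= b ->
  tent a b t = ramp a t - 2 * ramp ((a + b) / 2) t + ramp b t.
Proof.
move=> ab; rewrite /tent /ramp /Num.max /Num.min.
by repeat case: ifP; lra.
Qed.

Lemma tent_eq0 a b t : (t <= a) || (b <= t) -> tent a b t = 0.
Proof.
by move=> h; rewrite /tent max_l// ge_min !subr_le0.
Qed.

Lemma tent_lipschitz a b a' b' t :
  `|tent a b t - tent a' b' t| <= `|a - a'| + `|b - b'|.
Proof.
rewrite /tent ler_norml; have := ler_norm (a - a'); have := ler_norm (b - b').
have := ler_norm (- (a - a')); have := ler_norm (- (b - b')).
rewrite !normrN /Num.max /Num.min => h1 h2 h3 h4.
by apply/andP; split; repeat case: ifP; lra.
Qed.

(** Cutting a tent at its midpoint: each half tent lies below the whole one, and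
    only one of them is nonzero at a given point. *)
Lemma tent_split a b t (e := (a + b) / 2) : a <= b ->
  tent a e t ^+ 2 + tent e b t ^+ 2 <= tent a b t ^+ 2.
Proof.
move=> ab.
have [te|et] := leP t e.
  rewrite (@tent_eq0 e) ?te// expr0n/= addr0 ler_sqr ?nnegrE ?tent_ge0//.
  by rewrite /tent; move: te; rewrite /e /Num.max /Num.min => te; repeat case: ifP; lra.
rewrite (@tent_eq0 a) ?(ltW et) ?orbT// expr0n/= add0r ler_sqr ?nnegrE ?tent_ge0//.
by rewrite /tent; move: et; rewrite /e /Num.max /Num.min => te; repeat case: ifP; lra.
Qed.

(** Near the midpoint the whole tent is near its maximum (b - a) / 2, while the
    half tents are small there.  The quantities 1/8 are convenient rather than
    optimal: on |t - e| <= (b - a) / 8 the tent is at least 3 (b - a) / 8 and the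
    half tents are at most (b - a) / 8, and (9 - 1) / 64 = 1 / 8. *)
Lemma tent_split_gap a b t (e := (a + b) / 2) : a <= b ->
  `|t - e| <= (b - a) / 8 ->
  tent a e t ^+ 2 + tent e b t ^+ 2 + (b - a) ^+ 2 / 8 <= tent a b t ^+ 2.
Proof.
move=> ab; rewrite ler_norml => /andP[]; rewrite /e => t1 t2.
have big : 3 * (b - a) / 8 <= tent a b t.
  by rewrite /tent /Num.max /Num.min; repeat case: ifP; lra.
have big2 : (3 * (b - a) / 8) ^+ 2 <= tent a b t ^+ 2.
  by rewrite ler_sqr ?nnegrE ?tent_ge0//; lra.
suff small : tent a e t ^+ 2 + tent e b t ^+ 2 <= ((b - a) / 8) ^+ 2.
  by apply: le_trans big2; move: small; rewrite /e; nra.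
have [te|et] := leP t e.
  rewrite (@tent_eq0 e) ?te// expr0n/= addr0 ler_sqr ?nnegrE ?tent_ge0//; last lra.
  by rewrite /tent; move: te; rewrite /e /Num.max /Num.min => te; repeat case: ifP; lra.
rewrite (@tent_eq0 a) ?(ltW et) ?orbT// expr0n/= add0r.
rewrite ler_sqr ?nnegrE ?tent_ge0//; last lra.
by rewrite /tent; move: et; rewrite /e /Num.max /Num.min => te; repeat case: ifP; lra.
Qed.

End Tent.

Section TentEnergy.
Variable R : realType.
Local Notation plane := (measurableTypeR R * measurableTypeR R)%type.

(** The real power function with exponent -1 is measurable and agrees with the
    inverse on nonnegative numbers; the factor [x] restores the sign. *)
Lemma invr_measurable : measurable_fun setT (@GRing.inv R).
Proof.
rewrite (_ : GRing.inv = fun x : R => x * (x ^+ 2) `^ (-1)); last first.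
  apply/funext => x; rewrite powR_inv1 ?sqr_ge0//.
  have [->|x0] := eqVneq x 0; first by rewrite invr0 mul0r.
  by rewrite expr2 invfM mulrA divff ?mul1r.
apply: measurable_funM; first exact: measurable_id.
apply: (measurableT_comp (measurable_powR (-1))).
exact: exprn_measurable.
Qed.

Definition weighted_tent (a b x : R) : R := tent a b `|cos x| ^+ 2 / sin x.

(** Since 1 - |cos x| <= sin x ^+ 2, a function of the height that vanishes
    linearly at the poles remains bounded after its square is divided by sin. *)
Lemma polar_angle (x : R) : `[0, pi]%classic x ->
  [/\ 0 <= sin x, sin x <= 1, `|cos x| <= 1 & 1 - `|cos x| <= sin x ^+ 2].
Proof.
rewrite /= in_itv/= => xI.
have c1 : `|cos x| <= 1 by rewrite ler_norml cos_geN1 cos_le1.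
split; [exact: sin_ge0_pi|by rewrite sin_le1|by []|].
have := cos2Dsin2 x; rewrite -(real_normK (num_real (cos x))).
have := normr_ge0 (cos x); nra.
Qed.

Lemma weighted_tent_le1 a b x : b <= 1 -> `[0, pi]%classic x ->
  `|weighted_tent a b x| <= 1.
Proof.
move=> b1 /polar_angle[s0 s1 c1 cs]; rewrite /weighted_tent.
rewrite ger0_norm ?divr_ge0 ?sqr_ge0//.
have [->|sn0] := eqVneq (sin x) 0; first by rewrite invr0 mulr0.
have sp : 0 < sin x by rewrite lt_def sn0.
rewrite ler_pdivrMr// mul1r.
have := tent_le a b1 c1; have := tent_ge0 a b `|cos x|.
move: (tent _ _ _) (normr_ge0 (cos x)) => T c0 T0 T1; nra.
Qed.

Lemma continuous_tent (a b : R) : continuous (tent a b).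
Proof.
apply: max_fun_continuous => t; first exact: cvg_cst.
apply: min_fun_continuous => {}t.
  by apply: cvgB; [exact: cvg_id|exact: cvg_cst].
by apply: cvgB; [exact: cvg_cst|exact: cvg_id].
Qed.

Lemma tame_weighted_tent a b : b <= 1 -> tame (fun p : plane => weighted_tent a b p.1).
Proof.
move=> b1; apply: tame_latitude; last by move=> x xI; exact: (weighted_tent_le1 a b1 xI).
apply: measurable_funM.
  apply: measurable_funX; apply: continuous_measurable_fun => x.
  apply: (@continuous_comp _ _ _ (fun x : R => `|cos x|) (tent a b)).
    by apply: cvg_norm; exact: continuous_cos.
  exact: continuous_tent.
apply: (measurableT_comp invr_measurable).
by apply: continuous_measurable_fun; exact: continuous_sin.
Qed.

(** The minimum with 1 makes the energy finite and continuous for all [a] and [b]: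
    a tent that is positive at a pole would have infinite weighted energy. *)
Definition tent_energy (a b : R) : R :=
  polar_integral (fun p => weighted_tent a (Num.min b 1) p.1).

Let min1 (b : R) : Num.min b 1 <= 1.
Proof. by rewrite ge_min lexx orbT. Qed.

(** In the difference of the two squares one factor is at most
    |a - a'| + |b - b'|, while the other vanishes linearly at the poles and
    compensates the weight. *)
Lemma tent_energy_lipschitz a b a' b' :
  `|tent_energy a b - tent_energy a' b'| <=
  4 * pi ^+ 2 * (`|a - a'| + `|Num.min b 1 - Num.min b' 1|).
Proof.
move: (min1 b) (min1 b'); rewrite /tent_energy.
move: (Num.min b 1) (Num.min b' 1) => {}b {}b' b1 b1'.
set D := `|a - a'| + `|b - b'|.
rewrite -polar_integralB; [|exact: tame_weighted_tent..].
apply: le_trans (le_norm_polar_integral _) _.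
  by apply: tameB; exact: tame_weighted_tent.
have -> : 4 * pi ^+ 2 * D = polar_integral (fun=> 2 * D).
  by rewrite polar_integral_cst; ring.
apply: le_polar_integral.
- by apply/tame_norm/tameB; exact: tame_weighted_tent.
- exact: tame_cst.
move=> p [/polar_angle[s0 s1 c1 cs] _]; rewrite /weighted_tent -mulrBl subr_sqr.
have DL := tent_lipschitz a b a' b' `|cos p.1|.
have D0 : 0 <= D by rewrite /D addr_ge0.
rewrite !normrM (ger0_norm (x := (sin p.1)^-1)) ?invr_ge0//.
have [->|sn0] := eqVneq (sin p.1) 0; first by rewrite invr0 mulr0 mulr_ge0.
have sp : 0 < sin p.1 by rewrite lt_def sn0.
rewrite ler_pdivrMr//.
have := tent_le a b1 c1; have := tent_ge0 a b `|cos p.1|.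
have := tent_le a' b1' c1; have := tent_ge0 a' b' `|cos p.1|.
rewrite -/D in DL *.
move: (tent a b _) (tent a' b' _) DL => T T' DL h1 h2 h3 h4.
rewrite (ger0_norm (addr_ge0 h3 h1)).
have : T + T' <= 2 * sin p.1 by nra.
have := normr_ge0 (T - T'); nra.
Qed.

Lemma tent_energy_degenerate a : tent_energy a a = 0.
Proof.
transitivity (polar_integral (fun=> 0 : R)); last first.
  by rewrite polar_integral_cst mul0r.
apply: eq_polar_integral => p _; rewrite /weighted_tent tent_eq0 ?expr0n ?mul0r//.
by have [//|/ltW h] := leP `|cos p.1| a; rewrite ge_min h.
Qed.

(** The weight 1 / sin is at least sin, so the gain of [tent_split_gap] is bounded
    below by a multiple of the area of the zone of heights within (b - a) / 8 of
    the midpoint. *)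
Lemma tent_energy_split a b (e := (a + b) / 2) : 0 <= a -> a < b -> b <= 1 ->
  tent_energy a e + tent_energy e b < tent_energy a b.
Proof.
move=> a0 ab b1.
have eb : e <= 1 by rewrite /e; lra.
rewrite /tent_energy !min_l// -subr_gt0.
pose d := (b - a) / 8.
have d0 : 0 < d by rewrite /d; lra.
have tw1 := tame_weighted_tent a eb; have tw2 := tame_weighted_tent e b1.
have tw := tame_weighted_tent a b1.
rewrite -polar_integralD// -polar_integralB//; last exact: tameD.
have tc c : tame (fun p : plane => step c (cos p.1) * sin p.1).
  by apply: tame_cap; exact: continuous_sin_polar.
apply: (@lt_le_trans _ _ (polar_integral (fun p => (b - a) ^+ 2 / 8 *
    (step (e - d) (cos p.1) * sin p.1 - step (e + d) (cos p.1) * sin p.1)))).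
  rewrite polar_integralZ; last exact: tameB.
  rewrite polar_integralB// !cap_area; [|rewrite /e /d; lra..].
  have -> : 2 * pi * (1 - (e - d)) - 2 * pi * (1 - (e + d)) = 2 * pi * (2 * d) by ring.
  have q0 : 0 < (b - a) ^+ 2 / 8 by rewrite divr_gt0 ?exprn_gt0 ?subr_gt0.
  by apply: mulr_gt0 => //; apply: mulr_gt0; rewrite mulr_gt0 ?pi_gt0.
apply: le_polar_integral.
- by apply: tameZ; apply: tameB.
- by apply: tameB => //; exact: tameD.
move=> p [/polar_angle[s0 s1 c1 cs] _]; rewrite /weighted_tent.
rewrite -!mulrDl -mulrBl -mulrBl.
have [->|sn0] := eqVneq (sin p.1) 0; first by rewrite invr0 !mulr0.
have sp : 0 < sin p.1 by rewrite lt_def sn0.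
rewrite ler_pdivlMr//.
have [eq0|] := leP (step (e - d) (cos p.1) - step (e + d) (cos p.1)) 0.
  apply: (@le_trans _ _ 0).
    rewrite mulr_le0_ge0// mulr_ge0_le0 ?divr_ge0 ?sqr_ge0//.
    by rewrite mulr_le0_ge0.
  by rewrite subr_ge0; apply: tent_split; exact: ltW.
rewrite {1 2}/step; case: (leP (e - d)) => [edc|_]; last first.
  by case: (leP (e + d)) => _ /=; lra.
case: (leP (e + d)) => [_|ced _] /=; first by rewrite subrr ltxx.
have cp : 0 <= cos p.1 by move: edc; rewrite /e /d; lra.
rewrite (ger0_norm cp) (_ : step (e - d) (cos p.1) = 1); last by rewrite /step edc.
rewrite (_ : step (e + d) (cos p.1) = 0); last by rewrite /step leNgt ced.
rewrite subr0 mul1r.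
have gap : `|cos p.1 - e| <= (b - a) / 8.
  by rewrite ler_norml -/d; apply/andP; split; lra.
have := tent_split_gap (ltW ab) gap; rewrite -/e.
move: (tent a b _) (tent a e _) (tent e b _) => A B C h.
have : 0 <= (b - a) ^+ 2 / 8 by rewrite divr_ge0 ?sqr_ge0.
move: ((b - a) ^+ 2 / 8) h => q h q0.
have s2 : sin p.1 * sin p.1 <= 1 by nra.
rewrite -mulrA; apply: (@le_trans _ _ q); last by lra.
by rewrite -[leRHS]mulr1 ler_wpM2l.
Qed.

Lemma continuous_tent_energy (T : topologicalType) (f g : T -> R) :
  continuous f -> continuous g -> continuous (fun t => tent_energy (f t) (g t)).
Proof.
move=> cf cg t; apply/cvgrPdist_le => eps eps0.
have cg1 : continuous (fun t => Num.min (g t) 1).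
  by apply: min_fun_continuous => // x; exact: cvg_cst.
pose K : R := 4 * pi ^+ 2.
have K0 : 0 < K by apply: mulr_gt0 => //; apply: exprn_gt0; exact: pi_gt0.
have e0 : 0 < eps / (K * 2) by apply: divr_gt0 => //; exact: mulr_gt0.
have /cvgrPdist_le/(_ _ e0) nf := cf t.
have /cvgrPdist_le/(_ _ e0) ng := cg1 t.
near=> s.
apply: le_trans (tent_energy_lipschitz _ _ _ _) _; rewrite -/K.
apply: (@le_trans _ _ (K * (eps / (K * 2) + eps / (K * 2)))).
  rewrite ler_wpM2l ?(ltW K0)//.
  by apply: lerD; near: s; [exact: nf|exact: ng].
by rewrite le_eqVlt; apply/orP; left; apply/eqP; field; exact: lt0r_neq0.
Unshelve. all: by end_near. Qed.

End TentEnergy.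

(** * The zeros of the moment as coordinates *)

Section Nodes.
Variable R : realType.

Lemma closed_sublevel (T : topologicalType) (f : T -> R) (a : R) :
  continuous f -> closed [set t | f t <= a].
Proof.
move=> cf; apply: (@preimage_closed _ _ f [set x | x <= a]); last exact: closed_le.
by move=> t _; exact: cf.
Qed.

Section Entry.
Variable n : nat.
Implicit Type z : 'rV[R]_n.

(** Entries with indices beyond [n] are 0, which allows recursion on natural
    numbers in [node]. *)
Definition entry z (k : nat) : R := if insub k is Some i then z 0 i else 0.

Lemma entry_ord z (i : 'I_n) : entry z i = z 0 i.
Proof. by rewrite /entry valK. Qed.

Lemma entry_row (g : nat -> R) k : (k < n)%N ->
  entry (\row_(i < n) g i) k = g k.
Proof. by move=> kn; rewrite -[k]/(val (Ordinal kn)) entry_ord mxE. Qed.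

Lemma continuous_entry k : continuous (fun z => entry z k).
Proof.
rewrite /entry; case: (insub k) => [i|]; last exact: cst_continuous.
by move=> z; exact: coord_continuous.
Qed.

(** The zeros c_k of the moment in the upper half, obtained by reflecting at the
    interfaces, since each interface is the midpoint of two consecutive zeros. *)
Fixpoint node z (k : nat) : R :=
  if k is k'.+1 then 2 * entry z k' - node z k' else 0.

Arguments node : simpl never.

Lemma node0 z : node z 0 = 0. Proof. by []. Qed.

Lemma nodeS z k : node z k.+1 = 2 * entry z k - node z k.
Proof. by []. Qed.

Lemma continuous_node k : continuous (fun z => node z k).
Proof.
elim: k => [|k IH]; first exact: cst_continuous.
move=> z; exact: (cvgB (cvgM (cvg_cst (2 : R)) (@continuous_entry k z)) (IH z)).
Qed.

Lemma node_mid z (i : 'I_n) : z 0 i = (node z i + node z i.+1) / 2.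
Proof. by rewrite nodeS entry_ord; field. Qed.

Lemma node_row (c : nat -> R) k : c 0%N = 0 -> (k <= n)%N ->
  node (\row_(i < n) ((c i + c i.+1) / 2)) k = c k.
Proof.
move=> c0; elim: k => [//|k IH] kn.
rewrite nodeS IH 1?ltnW// (entry_row (fun k => (c k + c k.+1) / 2))//.
by field.
Qed.

Lemma node_alternating z k :
  node z k = 2 * (-1) ^+ k * \sum_(i < k) (-1) ^+ i.+1 * entry z i.
Proof.
elim: k => [|k IH]; first by rewrite big_ord0 mulr0.
rewrite big_ord_recr/= nodeS IH !exprS.
have s2 : ((-1) ^+ k) ^+ 2 = 1 :> R by rewrite sqrr_sign.
move: s2; set s := (-1) ^+ k; move=> s2.
transitivity (2 * entry z k * s ^+ 2 - 2 * s * \sum_(i < k) (-1) ^+ i.+1 * entry z i).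
  by rewrite s2 mulr1.
by ring.
Qed.

(** The mass constraint says that the last zero of the moment is the north pole. *)
Lemma Mset_node z : Mset z <-> node z n = 1.
Proof.
rewrite /Mset/= node_alternating.
rewrite (_ : \sum_(i < n) _ * entry z i = \sum_(i < n) (-1) ^+ i.+1 * z 0 i); last first.
  by apply: eq_bigr => i _; rewrite entry_ord.
have s2 : ((-1) ^+ n) ^+ 2 = 1 :> R by rewrite sqrr_sign.
have s0 : (-1) ^+ n != 0 :> R by rewrite signr_eq0.
split=> [->|h].
  by rewrite -[RHS]s2; field.
apply: (mulfI s0); rewrite mulrA -expr2 s2.
by move: h; rewrite -mulrA; lra.
Qed.

(** The closure of the set of admissible positions of the zeros, in the
    coordinates [z]. *)
Definition node_simplex : set 'rV[R]_n :=
  [set z | node z n = 1 /\ forall k, (k < n)%N -> node z k <= node z k.+1].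

Lemma closed_node_simplex : closed node_simplex.
Proof.
rewrite (_ : node_simplex = [set z | node z n = 1] `&`
   \bigcap_(k in [set k | (k < n)%N]) [set z | node z k <= node z k.+1]).
  apply: closedI.
    apply: (@preimage_closed _ _ (fun z => node z n) [set x | x = 1]).
      by move=> z _; exact: continuous_node.
    exact: closed_eq.
  apply: closed_bigI => k _.
  rewrite (_ : [set z | _] = [set z | node z k - node z k.+1 <= 0]).
    apply: closed_sublevel => z.
    exact: (cvgB (@continuous_node k z) (@continuous_node k.+1 z)).
  by apply/seteqP; split=> z /=; rewrite subr_le0.
by apply/seteqP; split=> z /= [h1 h2]; split=> // k; exact: h2.
Qed.

Section InSimplex.
Variable z : 'rV[R]_n.
Hypothesis zK : node_simplex z.

Lemma node_mono i j : (i <= j)%N -> (j <= n)%N -> node z i <= node z j.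
Proof.
move=> + jn; elim: j jn => [_|j IH jn]; first by rewrite leqn0 => /eqP ->.
rewrite leq_eqVlt => /predU1P[->//|ij].
by apply: le_trans (IH (ltnW jn) ij) _; exact: zK.2.
Qed.

Lemma node_ge0 i : (i <= n)%N -> 0 <= node z i.
Proof. by move=> ni; exact: (@node_mono 0%N). Qed.

Lemma node_le1 i : (i <= n)%N -> node z i <= 1.
Proof. by move=> ni; rewrite -zK.1; exact: node_mono. Qed.

Lemma simplex_coord i : 0 <= z 0 i <= 1.
Proof.
rewrite node_mid; have := @node_ge0 i (ltnW (ltn_ord i)); have := node_le1 (ltn_ord i).
have := @node_le1 i (ltnW (ltn_ord i)); have := node_ge0 (ltn_ord i); lra.
Qed.

Lemma simplex_coord_mono (i j : 'I_n) : (i < j)%N -> z 0 i <= z 0 j.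
Proof.
move=> ij; rewrite !node_mid.
have h1 := @node_mono i j (ltnW ij) (ltnW (ltn_ord j)).
have h2 : node z i.+1 <= node z j.+1 by apply: node_mono; [exact: ltnW|exact: ltn_ord].
lra.
Qed.

Lemma simplex_Mset : Mset z. Proof. by apply/Mset_node; exact: zK.1. Qed.

Lemma simplex_Zset : (forall k, (k < n)%N -> node z k < node z k.+1) -> Zset z.
Proof.
move=> zs; split=> [i|i j ij|i]; rewrite ?node_mid.
- have := @node_ge0 i (ltnW (ltn_ord i)); have := zs _ (ltn_ord i); lra.
- have h1 := @node_mono i.+1 j ij (ltnW (ltn_ord j)).
  have := zs _ (ltn_ord i); have := zs _ (ltn_ord j); lra.
- have := node_le1 (ltn_ord i); have := zs _ (ltn_ord i); lra.
Qed.

End InSimplex.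

Lemma compact_node_simplex : compact node_simplex.
Proof.
apply: (subclosed_compact closed_node_simplex
  (B := [set z : 'rV[R]_n | forall i, `[0, 1]%classic (z ord0 i)])).
  by apply: (@rV_compact _ n (fun=> `[(0 : R), 1]%classic)) => i; exact: segment_compact.
by move=> z zK i /=; rewrite in_itv/=; exact: simplex_coord.
Qed.

End Entry.

Lemma ramp_opp (a t : R) : ramp (- a) (- t) = ramp a t - (t - a).
Proof. by rewrite /ramp /Num.max; repeat case: ifP; lra. Qed.

(** A pattern that is symmetric with respect to the equator has mass 0 in each
    half, so its moment is odd. *)
Lemma moment_odd n (z : 'rV[R]_n) t : Mset z -> moment z (- t) = - moment z t.
Proof.
move=> zM; rewrite /moment.
have -> : alt_sum z (fun a => ramp a (- t)) =
    alt_sum z (fun a => (1 - a) - ramp a t).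
  rewrite /alt_sum; congr (_ * _); apply: eq_bigr => i _; congr (_ * _).
  rewrite -{1}[z 0 i]opprK !ramp_opp; ring.
by rewrite alt_sumB alt_sum_defect//; ring.
Qed.

Lemma telescope_alternating n (q : nat -> R) :
  \sum_(i < n) (-1) ^+ i * (q i + q i.+1) = q 0%N - (-1) ^+ n * q n.
Proof.
elim: n => [|n IH]; first by rewrite big_ord0 expr0 mul1r subrr.
by rewrite big_ord_recr/= IH exprS; ring.
Qed.

(** Each tent is a second difference of ramps, at its two end points and at the
    midpoint ([tent_ramp]).  The ramps at the end points telescope, and those at
    the midpoints are the ramps of the pattern. *)
Lemma moment_tents n (z : 'rV[R]_n) t : node_simplex z -> 0 <= t <= 1 ->
  moment z t = - (-1) ^+ n *
    \sum_(i < n) (-1) ^+ i * tent (node z i) (node z i.+1) t.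
Proof.
move=> zK /andP[t0 t1]; pose q k := ramp (node z k) t - t - node z k.
have qE : \sum_(i < n) (-1) ^+ i * (q i + q i.+1) = - (-1) ^+ n * q n.
  rewrite telescope_alternating (_ : q 0%N = 0) ?sub0r ?mulNr//.
  by rewrite /q node0 /ramp !subr0 max_r// subrr.
have qn : q n = - (t + 1).
  by rewrite /q zK.1 /ramp max_l ?subr_le0//; ring.
have s2 : ((-1) ^+ n) ^+ 2 = 1 :> R by rewrite sqrr_sign.
rewrite /moment /alt_sum.
transitivity ((-1) ^+ n * \sum_(i < n) (-1) ^+ i * (q i + q i.+1) -
  (-1) ^+ n * (\sum_(i < n) (-1) ^+ i * tent (node z i) (node z i.+1) t) - (t + 1)).
  congr (_ - _); rewrite -mulrBr -sumrB [2 * _]mulrC -mulrA mulr_sumr.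
  congr (_ * _).
  apply: eq_bigr => i _.
  rewrite tent_ramp; last exact: zK.2.
  rewrite -node_mid /q.
  have -> : ramp (- z 0 i) t = t + z 0 i.
    have /andP[zi0 _] := simplex_coord zK i.
    by rewrite /ramp opprK max_r// addr_ge0.
  by rewrite {2}[z 0 i]node_mid; field.
rewrite qE qn; move: s2; set s := (-1) ^+ n; set S := \sum_(i < n) _ => s2.
(* here s ^+ 2 = 1 *)
transitivity (s ^+ 2 * (t + 1) - (t + 1) - s * S); first by ring.
by rewrite s2; ring.
Qed.

Lemma sqr_sum_disjoint n (s x : nat -> R) :
  (forall i, s i ^+ 2 = 1) ->
  (forall i j, (i < j)%N -> (j < n)%N -> x i * x j = 0) ->
  (\sum_(i < n) s i * x i) ^+ 2 = \sum_(i < n) x i ^+ 2.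
Proof.
move=> s2; elim: n => [|n IH] x0; first by rewrite !big_ord0 expr0n.
rewrite !big_ord_recr/= -IH; last by move=> i j ij jn; apply: x0 => //; exact: ltnW.
have c0 : (\sum_(i < n) s i * x i) * x n = 0.
  by rewrite mulr_suml big1// => i _; rewrite -mulrA x0 ?mulr0.
move: c0; set S := \sum_(i < n) _ => c0.
transitivity (S ^+ 2 + 2 * s n * (S * x n) + s n ^+ 2 * x n ^+ 2); first by ring.
by rewrite c0 s2 mulr0 addr0 mul1r.
Qed.

(** The tents have disjoint supports, so their signs disappear in the square. *)
Lemma moment_sqr n (z : 'rV[R]_n) t : node_simplex z -> -1 <= t <= 1 ->
  moment z t ^+ 2 = \sum_(i < n) tent (node z i) (node z i.+1) `|t| ^+ 2.
Proof.
move=> zK tI.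
have -> : moment z t ^+ 2 = moment z `|t| ^+ 2.
  have [t0|t0] := leP 0 t; first by rewrite ger0_norm.
  by rewrite ltr0_norm// moment_odd ?sqrrN//; exact: simplex_Mset.
have aI : 0 <= `|t| <= 1 by rewrite normr_ge0 ler_norml.
rewrite moment_tents// exprMn sqrrN sqrr_sign mul1r.
rewrite (sqr_sum_disjoint (s := fun i => (-1) ^+ i)
  (x := fun i => tent (node z i) (node z i.+1) `|t|))//.
  by move=> i; rewrite sqrr_sign.
move=> i j ij jn; have [ti|it] := leP (node z i.+1) `|t|.
  by rewrite tent_eq0 ?mul0r// ti orbT.
rewrite mulrC tent_eq0 ?mul0r// (le_trans (ltW it))//.
by apply: node_mono => //; exact: ltnW.
Qed.

End Nodes.

Arguments node : simpl never.

(** * The Dirichlet energy is not minimal at degenerate positions *)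

Section FieldEnergy.
Variables (R : realType) (n : nat).
Implicit Type z : 'rV[R]_n.

Definition field_energy z : R := \sum_(i < n) tent_energy (node z i) (node z i.+1).

Lemma continuous_field_energy : continuous field_energy.
Proof.
apply: continuous_sum => i.
by apply: continuous_tent_energy; exact: continuous_node.
Qed.

Lemma simplex_field_energy z : node_simplex z ->
  polar_integral (fun p => moment z (cos p.1) ^+ 2 / sin p.1) = field_energy z.
Proof.
move=> zK; rewrite /field_energy /tent_energy -polar_integral_sum; last first.
  by move=> i; apply: tame_weighted_tent; rewrite ge_min lexx orbT.
apply: eq_polar_integral => p _.
rewrite moment_sqr ?cos_geN1 ?cos_le1// mulr_suml; apply: eq_bigr => i _.
by rewrite min_l//; exact: node_le1.
Qed.

Lemma adjacent_change (P : pred nat) : (exists2 k, (k < n)%N & P k) ->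
  (exists2 k, (k < n)%N & ~~ P k) ->
  exists2 k, (k.+1 < n)%N & P k != P k.+1.
Proof.
move=> [k kn Pk] [j jn Pj]; apply: contrapT => nk.
have P0 i : (i < n)%N -> P i = P 0%N.
  elim: i => [//|i IH] in_; rewrite -IH; last exact: ltnW.
  by apply/esym/eqP; apply: contrapT => /negP h; apply: nk; exists i.
by move: Pj; rewrite P0// -(P0 k kn) Pk.
Qed.

(** The gaps between consecutive zeros add up to 1, so some gap is positive.  If
    some gap is 0, there is a zero c_(i+1) with one adjacent gap equal to 0 and
    the other positive.  Moving it to the midpoint of c_i and c_(i+2) cuts one
    tent into two and leaves the others unchanged. *)
Lemma degenerate_not_optimal z : node_simplex z ->
  (exists2 k, (k < n)%N & node z k = node z k.+1) ->
  exists2 z', node_simplex z' & field_energy z' < field_energy z.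
Proof.
move=> zK [k0 k0n k0e]; pose P k := node z k == node z k.+1.
have [] := @adjacent_change P.
- by exists k0 => //; exact/eqP.
- apply: contrapT => nP.
  have cst k : (k <= n)%N -> node z k = 0.
    elim: k => [//|k IH] kn; rewrite -IH; last exact: ltnW.
    apply/esym/eqP; apply: contrapT => /negP h; apply: nP.
    by exists k.
  by have := zK.1; rewrite cst// => /esym/eqP; rewrite oner_eq0.
move=> i in_ Pi.
have le1 : node z i <= node z i.+1 by apply: zK.2; exact: ltnW.
have le2 : node z i.+1 <= node z i.+2 by exact: zK.2.
have lt02 : node z i < node z i.+2.
  rewrite lt_neqAle (le_trans le1 le2) andbT; apply: contra Pi => /eqP e.
  have e1 : node z i = node z i.+1 by apply/eqP; rewrite eq_le le1 e le2.
  by rewrite /P -e1 e eqxx.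
pose e := (node z i + node z i.+2) / 2.
pose c k := if k == i.+1 then e else node z k.
pose z' : 'rV[R]_n := \row_(j < n) ((c j + c j.+1) / 2).
have cE k : (k <= n)%N -> node z' k = c k by exact: node_row.
have ci : c i = node z i by rewrite /c -[i in i == _]addn0 -addn1 eqn_add2l.
have ci1 : c i.+1 = e by rewrite /c eqxx.
have ci2 : c i.+2 = node z i.+2 by rewrite /c eqSS -[i in _ == i]addn0 -addn1 eqn_add2l.
exists z'.
  split=> [|k kn]; first by rewrite cE// /c gtn_eqF//; exact: zK.1.
  rewrite !cE ?(ltnW kn)//.
  have [->|ki] := eqVneq k i; first by rewrite ci ci1 /e; lra.
  have [->|ki1] := eqVneq k i.+1; first by rewrite ci1 ci2 /e; lra.
  by rewrite /c (negbTE ki1) eqSS (negbTE ki); exact: zK.2.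
have i_n : (i < n)%N by exact: ltnW.
pose oi := Ordinal i_n; pose oi1 := Ordinal in_.
have neq : oi1 != oi by rewrite -val_eqE/= gtn_eqF.
have split2 (f : 'I_n -> R) : \sum_j f j =
    f oi + f oi1 + \sum_(j | (j != oi) && (j != oi1)) f j.
  by rewrite (bigD1 oi)//= (bigD1 oi1)//= addrA.
rewrite /field_energy !split2/= !cE ?ci ?ci1 ?ci2 ?(ltnW in_) ?(ltnW i_n)//.
apply: ltr_leD.
  have h0 : 0 <= node z i by exact: node_ge0 (ltnW i_n).
  have h1 : node z i.+2 <= 1 by exact: node_le1.
  apply: lt_le_trans (tent_energy_split h0 lt02 h1) _.
  have [e1|n1] := eqVneq (node z i) (node z i.+1).
    by rewrite -e1 tent_energy_degenerate add0r.
  have [e2|n2] := eqVneq (node z i.+1) (node z i.+2).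
    by rewrite -e2 tent_energy_degenerate addr0.
  by move: Pi; rewrite /P (negbTE n1) (negbTE n2).
rewrite le_eqVlt; apply/orP; left; apply/eqP; apply: eq_bigr => j /andP[].
rewrite -!val_eqE/= => ji ji1; rewrite !cE ?(ltnW (ltn_ord j))//.
by rewrite /c (negbTE ji1) eqSS (negbTE ji).
Qed.

End FieldEnergy.

(** * Minimizers with one dominant continuous term *)

Section Confinement.
Variable R : realType.

(** A lower semicontinuous function attains its minimum on a compact set: the
    nonempty sublevel sets form a base of a filter, and any cluster point of it
    belongs to all of them. *)
Lemma compact_min_ereal (T : topologicalType) (K : set T) (E : T -> \bar R) :
  compact K -> K !=set0 -> (forall x, E x != -oo%E) ->
  (forall a : R, closed (K `&` [set x | (E x <= a%:E)%E])) ->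
  exists2 x0, K x0 & forall x, K x -> (E x0 <= E x)%E.
Proof.
move=> cK [k0 Kk0] Efin clE.
pose I := [set a : R | exists2 y, K y & (E y <= a%:E)%E].
have [[y Ky Ey]|noy] := pselect (exists2 y, K y & (E y < +oo)%E); last first.
  exists k0 => // x Kx; have -> : E x = +oo%E; last exact: leey.
  apply/eqP; apply: contrapT => /negP xy; apply: noy; exists x => //.
  by rewrite ltey.
have [a0 Ia0] : I !=set0.
  have := Efin y; case ey : (E y) Ey => [r| |] // _ _.
  by exists r, y => //; rewrite ey.
pose F := filter_from I (fun a => K `&` [set x | (E x <= a%:E)%E]).
have FF : ProperFilter F.
  apply: filter_from_proper; last first.
    by move=> a [x Kx Ex]; exists x; split.
  apply: filter_from_filter; first by exists a0.
  move=> a b Ia Ib; exists (Num.min a b).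
    by have [_|_] := leP a b.
  move=> x [Kx /= Ex]; split; split=> //=; apply: le_trans Ex _.
    by rewrite lee_fin ge_min lexx.
  by rewrite lee_fin ge_min lexx orbT.
have FK : F K by exists a0 => // x [].
have [p [Kp clp]] := cK _ FF FK.
have Ip a : I a -> (E p <= a%:E)%E.
  move=> Ia; suff /clE[] : closure (K `&` [set x | (E x <= a%:E)%E]) p by [].
  by move=> B pB; apply: clp => //; exists a.
exists p => // x Kx; case Ex : (E x) => [r| |].
- by apply: Ip; exists x => //; rewrite Ex.
- exact: leey.
- by have := Efin x; rewrite Ex.
Qed.

(** Let xs minimize [G] on [K] and let m > G xs be a lower bound of [G] where
    [gap] is not positive.  If [H] is infinite on a whole neighbourhood of xs in
    [K], then xs is a local minimizer for every gamma.  Otherwise there is y in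
    [K] with H y finite and G y < m, and once gamma (m - G y) exceeds H y the
    point y has less energy than all points where [gap] is not positive, which
    are thus no minimizers. *)
Lemma strong_confinement (T : topologicalType) (K : set T) (G gap : T -> R)
    (H : T -> \bar R) :
  compact K -> K !=set0 -> continuous G -> continuous gap ->
  (forall x, (0 <= H x)%E) ->
  (forall gamma a : R, closed (K `&` [set x | (H x + (gamma * G x)%:E <= a%:E)%E])) ->
  (forall x, K x -> gap x <= 0 -> exists2 y, K y & G y < G x) ->
  exists gamma0 : R, 0 < gamma0 /\ forall gamma, gamma0 <= gamma ->
    exists x0, [/\ K x0, 0 < gap x0 &
      \forall x \near x0, K x ->
        (H x0 + (gamma * G x0)%:E <= H x + (gamma * G x)%:E)%E].
Proof.
move=> cK K0 cG cgap H0 clE imp.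
have [xs Kxs xsmin] : exists2 x, K x & forall y, K y -> G x <= G y.
  have [x] := compact_EVT_min K0 cK (continuous_subspaceT cG).
  by rewrite inE => Kx xm; exists x => // y Ky; apply: xm; rewrite inE.
have gs : 0 < gap xs.
  rewrite ltNge; apply/negP => gs; have [y Ky] := imp _ Kxs gs.
  by rewrite ltNge xsmin.
have [m Gm bm] : exists2 m, G xs < m & forall x, K x -> gap x <= 0 -> m <= G x.
  pose B := K `&` [set x | gap x <= 0].
  have cB : compact B.
    by apply: compact_closedI => //; apply: closed_sublevel.
  have [B0|/set0P B0] := eqVneq B set0.
    exists (G xs + 1) => [|x Kx gx]; first by rewrite ltrDl.
    by have : B x by []; rewrite B0.
  have [b] := compact_EVT_min B0 cB (continuous_subspaceT cG).
  rewrite inE => -[Kb gb] bmin; exists (G b).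
    by have [y Ky] := imp _ Kb gb; apply: le_lt_trans; exact: xsmin.
  by move=> x Kx gx; apply: bmin; rewrite inE.
(* either [H] is finite somewhere with G < m, or it is infinite near [xs] *)
have [[y [Ky Gy Hy]]|noy] :=
  pselect (exists y, [/\ K y, G y < m & (H y < +oo)%E]); last first.
  have Hoo : \forall x \near xs, K x -> H x = +oo%E.
    have : \forall x \near xs, G x < m.
      exact: (cvgr_lt (G xs) (cG xs) _ Gm).
    apply: filterS => x Gx Kx; apply/eqP; apply: contrapT => /negP Hx.
    by apply: noy; exists x; split => //; rewrite ltey.
  exists 1; split=> // gamma _; exists xs; split => //.
  by apply: filterS Hoo => x Hx Kx; rewrite (Hx Kx) addye// leey.
have Hfin : H y \is a fin_num by rewrite ge0_fin_numE.
pose h := fine (H y); have hE : H y = h%:E by rewrite /h fineK.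
have h0 : 0 <= h by rewrite /h fine_ge0.
exists ((h + 1) / (m - G y)); split.
  by rewrite divr_gt0 ?subr_gt0// ltr_wpDl.
move=> gamma; rewrite ler_pdivrMr ?subr_gt0// => hg.
have g0 : 0 <= gamma.
  rewrite leNgt; apply/negP => gn.
  have : gamma * (m - G y) < 0 by rewrite nmulr_rlt0 ?subr_gt0.
  by lra.
have [|x0 Kx0 xmin] := @compact_min_ereal _ K
    (fun x => H x + (gamma * G x)%:E)%E cK K0 _ (clE gamma).
  by move=> x; rewrite adde_eq_ninfty; have := H0 x; case: (H x).
exists x0; split=> //; last by apply: nearW => x Kx; exact: xmin.
rewrite ltNge; apply/negP => gx0.
have := xmin _ Ky; rewrite leNgt => /negP; apply.
rewrite hE -EFinD; apply: (@lt_le_trans _ _ (gamma * m)%:E).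
  by rewrite lte_fin; move: hg; rewrite mulrBr; lra.
apply: (@le_trans _ _ (gamma * G x0)%:E).
  by rewrite lee_fin ler_wpM2l// bm.
by rewrite -[leLHS]add0e leeD2r.
Qed.

End Confinement.

(** * Local minimizers of the energy of patterns *)

Section PatternEnergy.
Variables (R : realType) (n : nat).
Implicit Type z : 'rV[R]_n.

(** A continuous function that is positive exactly in the interior of the simplex,
    when restricted to the simplex. *)
Definition gap_product z : R := \prod_(k < n) (node z k.+1 - node z k).

Lemma continuous_gap_factor k : continuous (fun z => node z k.+1 - node z k).
Proof.
by move=> z; exact: (cvgB (@continuous_node _ _ k.+1 z) (@continuous_node _ _ k z)).
Qed.

Lemma continuous_gap_product : continuous gap_product.
Proof.
apply: continuous_big => //; first exact: mul_continuous.
by move=> i _; exact: continuous_gap_factor.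
Qed.

Lemma gap_product_gt0 z : node_simplex z -> 0 < gap_product z ->
  forall k, (k < n)%N -> node z k < node z k.+1.
Proof.
move=> zK gz k kn; rewrite lt_neqAle zK.2// andbT; apply/eqP => e.
move: gz; rewrite /gap_product (bigD1 (Ordinal kn))//= e subrr mul0r.
by rewrite ltxx.
Qed.

Lemma gap_product_le0 z : node_simplex z -> gap_product z <= 0 ->
  exists2 k, (k < n)%N & node z k = node z k.+1.
Proof.
move=> zK gz; have /eqP : gap_product z = 0.
  apply/eqP; rewrite eq_le gz prodr_ge0// => i _.
  by rewrite subr_ge0; exact: zK.2.
rewrite prodf_seq_eq0 => /hasP[k _ /=]; rewrite subr_eq0 => /eqP e.
by exists k => //; exact: ltn_ord.
Qed.

Lemma node_simplex_nonempty : (1 <= n)%N -> @node_simplex R n !=set0.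
Proof.
move=> n0; pose c k : R := k%:R / n%:R.
have nR : n%:R != 0 :> R by rewrite pnatr_eq0 -lt0n.
have cE k : (k <= n)%N -> node (\row_(j < n) ((c j + c j.+1) / 2)) k = c k.
  by move=> kn; apply: node_row => //; rewrite /c mul0r.
exists (\row_(j < n) ((c j + c j.+1) / 2)); split=> [|k kn].
  by rewrite cE// /c divff.
by rewrite !cE ?(ltnW kn)// /c ler_wpM2r ?invr_ge0 ?ler0n// ler_nat.
Qed.

Definition perimeter z : \bar R :=
  ((2^-1)%:E * total_variation_sphere (axisymmetric_pattern (symmetric_interfaces z)))%E.

Lemma perimeter_ge0 z : (0 <= perimeter z)%E.
Proof. by rewrite mule_ge0 ?total_variation_ge0// lee_fin invr_ge0. Qed.

Lemma half_mule_add_le (x : \bar R) (a b : R) :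
  ((2^-1)%:E * x + b%:E <= a%:E)%E = (x <= (2 * (a - b))%:E)%E.
Proof.
case: x => [x| |].
- by rewrite -EFinM -EFinD !lee_fin; apply/idP/idP; lra.
- by rewrite gt0_muley ?lte_fin ?invr_gt0// addye// !leye_eq.
- by rewrite gt0_muleNy ?lte_fin ?invr_gt0// addNye !leNye.
Qed.

(** The sublevel set is an intersection of sets, one for each vector field in the
    definition of the total variation, that are closed by
    [tested_pattern_continuous]. *)
Lemma closed_energy_sublevel (gamma a : R) : closed (@node_simplex R n `&`
  [set z | (perimeter z + (gamma * field_energy z)%:E <= a%:E)%E]).
Proof.
pose tests := [set Q : 'rV[R]_n -> R | continuous Q /\
  exists2 X, admissible_field X & forall z, node_simplex z ->
    Q z = sphere_integral (fun x =>
      axisymmetric_pattern (symmetric_interfaces z) x * sphere_div X x)].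
rewrite (_ : _ `&` _ = @node_simplex R n `&` \bigcap_(Q in tests)
    [set z | Q z + 2 * gamma * field_energy z <= 2 * a]).
  apply: closedI; first exact: closed_node_simplex.
  apply: closed_bigI => Q [cQ _]; apply: closed_sublevel => z.
  exact: (cvgD (cQ z) (cvgM (cvg_cst (2 * gamma : R))
    (@continuous_field_energy _ _ z))).
apply/seteqP; split=> z [zK]; rewrite /perimeter /= half_mule_add_le => h; split=> //.
  move=> Q [_ [X aX QX]] /=; rewrite QX//.
  have : ((sphere_integral (fun x =>
      axisymmetric_pattern (symmetric_interfaces z) x * sphere_div X x))%:E
      <= (2 * (a - gamma * field_energy z))%:E)%E.
    by apply: le_trans h; apply: ereal_sup_ubound; exists X.
  by rewrite lee_fin; lra.
apply: ub_ereal_sup => _ [X aX <-]; rewrite lee_fin.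
have [Q cQ QX] := tested_pattern_continuous n aX.
have QE y : node_simplex y -> Q y = sphere_integral (fun x =>
    axisymmetric_pattern (symmetric_interfaces y) x * sphere_div X x).
  move=> yK; apply: QX; first exact: simplex_coord.
  exact: simplex_coord_mono.
have /= := h Q; rewrite QE// => hQ.
suff : tests Q by move=> /hQ; lra.
by split => //; exists X.
Qed.

Lemma simplex_pattern_energy (gamma : R) z : node_simplex z -> Zset z ->
  pattern_energy gamma z = (perimeter z + (gamma * field_energy z)%:E)%E.
Proof.
move=> zK zZ; rewrite balanced_pattern_energy ?simplex_field_energy//.
exact: simplex_Mset.
Qed.

End PatternEnergy.

Theorem theorem4p3 (R : realType) (n : nat) (hn : (1 <= n)%N) :
  exists gamma0 : R, 0 < gamma0 /\
    forall gamma : R, gamma0 <= gamma ->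
      exists z0 : 'rV[R]_n,
        (@Mset R n `&` @Zset R n) z0 /\
        \forall z \near z0, (@Mset R n `&` @Zset R n) z ->
          (pattern_energy gamma z0 <= pattern_energy gamma z)%E.
Proof.
have [|gamma0 [g0 conf]] := @strong_confinement R _ (@node_simplex R n)
    (@field_energy R n) (@gap_product R n) (@perimeter R n)
    (@compact_node_simplex R n) (node_simplex_nonempty R hn)
    (@continuous_field_energy R n) (@continuous_gap_product R n)
    (@perimeter_ge0 R n) (@closed_energy_sublevel R n).
  move=> z zK /(gap_product_le0 zK); exact: degenerate_not_optimal.
exists gamma0; split=> // gamma /conf[z0 [zK gz near_min]].
have gaps := gap_product_gt0 zK gz.
have zZ := simplex_Zset zK gaps.
exists z0; split; first by split; [exact: simplex_Mset|].
(* near [z0] the gaps between the nodes stay positive, which together with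
   the mass constraint places [z] in the simplex *)
have near_gaps : \forall z \near z0, forall k : 'I_n, node z k < node z k.+1.
  apply: (@filter_forall _ _ (fun (k : 'I_n) z => node z k < node z k.+1)
    (nbhs z0) (nbhs_filter z0)) => k.
  have : \forall z \near z0, 0 < node z k.+1 - node z k.
    apply: (cvgr_gt _ (@continuous_gap_factor R n k z0)).
    by rewrite subr_gt0; exact: gaps.
  by apply: filterS => z; rewrite subr_gt0.
apply: filterS2 near_min near_gaps => z zmin zgaps [zM zZ'].
have zK' : node_simplex z.
  split; first exact/Mset_node.
  by move=> k kn; exact/ltW/(zgaps (Ordinal kn)).
by rewrite !simplex_pattern_energy//; exact: zmin.
Qed.
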